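(* Consider the target/source factor model, Assumptions (A1)–(A5) and (A6)(1), and the oracle TransPCA estimators described in the context, with the numbers of factors $s$ and $r_k$, $k\in\{0\}\cup\mathcal A$, fixed and known, and the weak factor strength matrix $\mathbf D_w$ known. Then, as $N\to\infty$ and $\min_{k\in\{0\}\cup\mathcal A}T_k\to\infty$, there exists an invertible $s\times s$ matrix $\mathbf H_w$ such that $$\frac{1}{\sqrt N}\big\|\hat{\boldsymbol\Lambda}_w^{(0)}-\boldsymbol\Lambda_w^{(0)}\mathbf H_w\big\|=\frac{\sqrt{N^{\alpha_1}}}{\sqrt N}\, O_p\Big(\frac{\sqrt{T_0}N}{TN^{\alpha_s}}+\frac{T_0}{TN^{\alpha_s}}+\sum_{k\in\mathcal A}\Big(\frac{\sqrt{T_k}}{T}+\frac{T_k}{TN}\Big)+\frac1T\sum_{k\in\mathcal A}T_k\varepsilon\Big),$$ $$\frac{1}{\sqrt {T_0}}\big\|\hat{\mathbf F}_w^{(0)}-\mathbf F_w^{(0)}(\mathbf H_w^{-1})^\top\big\|=\frac{\sqrt{N}}{\sqrt {N^{\alpha_s}}}\, O_p\Big(\frac{\sqrt{T_0}N}{TN^{\alpha_s}}+\frac{T_0}{TN^{\alpha_s}}+\sum_{k\in\mathcal A}\Big(\frac{\sqrt{T_k}}{T}+\frac{T_k}{TN}\Big)+\frac1T\sum_{k\in\mathcal A}T_k\varepsilon\Big)+O_p\Big(\frac{1}{\sqrt{N^{\alpha_s}}}\Big).$$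
   Context: Model. $N$ is the cross-sectional dimension. The target panel $\mathbf X^{(0)}\in\mathbb R^{T_0\times N}$ satisfies $\mathbf X^{(0)}=\mathbf F^{(0)}\boldsymbol\Lambda^{(0)\top}+\mathbf E^{(0)}$ with factors $\mathbf F^{(0)}=(\mathbf f^{(0)}_1,\dots,\mathbf f^{(0)}_{T_0})^\top\in\mathbb R^{T_0\times r_0}$, loadings $\boldsymbol\Lambda^{(0)}\in\mathbb R^{N\times r_0}$ and idiosyncratic errors $\mathbf E^{(0)}$ with entries $\epsilon^{(0)}_{ti}$. Source panels $\mathbf X^{(k)}=\mathbf F^{(k)}\boldsymbol\Lambda^{(k)\top}+\mathbf E^{(k)}\in\mathbb R^{T_k\times N}$, $k\in[K]$, have $r_k$ factors (same notation). $\mathcal A\subseteq[K]$ is the (known) set of informative sources and $T=\sum_{k\in\{0\}\cup\mathcal A}T_k$. The target has $s$ weak factors: $\boldsymbol\Lambda^{(0)}=(\boldsymbol\Lambda^{(0)}_s,\boldsymbol\Lambda^{(0)}_w)$ with $\boldsymbol\Lambda^{(0)}_s\in\mathbb R^{N\times(r_0-s)}$ (strong) and $\boldsymbol\Lambda^{(0)}_w\in\mathbb R^{N\times s}$ (weak), and $\mathbf F^{(0)}=(\mathbf F^{(0)}_s,\mathbf F^{(0)}_w)$ correspondingly. For $k\in\mathcal A$ the columns of $\boldsymbol\Lambda^{(k)}$ split into $\boldsymbol\Lambda^{(k)}_{\mathcal T}\in\mathbb R^{N\times s}$ and $\boldsymbol\Lambda^{(k)}_{\mathcal T^c}\in\mathbb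 R^{N\times (r_k-s)}$, with $\mathbf P_{\boldsymbol\Lambda^{(k)}}=\mathbf P_{\boldsymbol\Lambda^{(k)}_{\mathcal T}}+\mathbf P_{\boldsymbol\Lambda^{(k)}_{\mathcal T^c}}$ and likewise $\mathbf P_{\boldsymbol\Lambda^{(0)}}=\mathbf P_{\boldsymbol\Lambda^{(0)}_w}+\mathbf P_{\boldsymbol\Lambda^{(0)}_s}$, where $\mathbf P_{\mathbf A}=\mathbf A(\mathbf A^\top\mathbf A)^{-1}\mathbf A^\top$. $\|\cdot\|$ is the spectral (Euclidean) norm, $\|\cdot\|_F$ Frobenius, $\|\cdot\|_{\max}$ the max-entry norm, $\boldsymbol\Lambda_{i,\cdot}$ the $i$-th row, $M$ a finite constant, $a\asymp b$ means same order. Assumptions. (A1) For all $k\in\{0\}\cup[K]$: $E\|\mathbf f^{(k)}_t\|^4\le M$, and $\mathbf F^{(k)\top}\mathbf F^{(k)}/T_k\to\boldsymbol\Sigma^{(k)}_F$ in probability as $T_k\to\infty$, with $\boldsymbol\Sigma^{(k)}_F$ positive definite with bounded distinct eigenvalues. (A2) $\|\boldsymbol\Lambda^{(k)}\|_{\max}\le M$ for all $k\in\{0\}\cup[K]$; $\|\mathbf D^{-1/2}\boldsymbol\Lambda^{(0)\top}\boldsymbol\Lambda^{(0)}\mathbf D^{-1/2}-\mathbf I_{r_0}\|\to0$ where $\mathbf D=\mathrm{diag}(\mathbf D_s,\mathbf D_w)$ is diagonal with $(\mathbf D_s)_{ii}\asymp N$, $i\in[r_0-s]$, $(\mathbf D_w)_{ii}\asymp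 N^{\alpha_i}$, $i\in[s]$, $0<\alpha_s\le\dots\le\alpha_1<1$; and $\|N^{-1}\boldsymbol\Lambda^{(k)\top}\boldsymbol\Lambda^{(k)}-\mathbf I_{r_k}\|\to0$ for all $k\in[K]$. (A3) $\|\mathbf E^{(k)}\|^2=O_p(N\vee T_k)$ for all $k\in\{0\}\cup[K]$. (A4) For each $t$: $E\|\mathbf D^{-1/2}\sum_i\boldsymbol\Lambda^{(0)\top}_{i,\cdot}\epsilon^{(0)}_{ti}\|^2\le M$ and $E\|N^{-1/2}\sum_i\boldsymbol\Lambda^{(k)\top}_{i,\cdot}\epsilon^{(k)}_{ti}\|^2\le M$ for $k\in[K]$; for each $i$: $E\|T_k^{-1/2}\sum_t\mathbf f^{(k)}_t\epsilon^{(k)}_{ti}\|^2\le M$ for $k\in\{0\}\cup[K]$. (A5) $\|\mathbf P_{\boldsymbol\Lambda^{(k)}_{\mathcal T}}-\mathbf P_{\boldsymbol\Lambda^{(0)}_w}\|_F\le\varepsilon$ for all $k\in\mathcal A$, and there is a constant $\kappa>0$ with $T^{-1}\|T_0\mathbf P_{\boldsymbol\Lambda^{(0)}_s}+\sum_{k\in\mathcal A}T_k\mathbf P_{\boldsymbol\Lambda^{(k)}_{\mathcal T^c}}\|\le 1-\kappa$. (A6) As $N,T\to\infty$: (1) $N/(\sqrt{T_0}N^{\alpha_s})\to0$; (2) $T_0\sqrt N/(T\sqrt{N^{\alpha_s}})\to0$. Oracle TransPCA. For $k\in\{0\}\cup\mathcal A$ let $\hat{\mathbf Q}^{(k)}$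 be the $N\times r_k$ matrix of the leading $r_k$ orthonormal eigenvectors of $\mathbf X^{(k)\top}\mathbf X^{(k)}/(NT_k)$; let $\hat{\mathbf P}^w=T^{-1}\sum_{k\in\{0\}\cup\mathcal A}T_k\hat{\mathbf Q}^{(k)}\hat{\mathbf Q}^{(k)\top}$ and $\hat{\mathbf Q}^{(0)}_w$ its leading $s$ orthonormal eigenvectors; $\hat{\boldsymbol\Lambda}^{(0)}_w=\hat{\mathbf Q}^{(0)}_w\mathbf D_w^{1/2}$ and $\hat{\mathbf F}^{(0)}_w=\mathbf X^{(0)}\hat{\boldsymbol\Lambda}^{(0)}_w\mathbf D_w^{-1}$. Then $\hat{\mathbf Q}^{(0)}_s$ is the leading $r_0-s$ eigenvectors of $(\mathbf I_N-\hat{\mathbf Q}^{(0)}_w\hat{\mathbf Q}^{(0)\top}_w)\,\tfrac{1}{T_0}\mathbf X^{(0)\top}\mathbf X^{(0)}(\mathbf I_N-\hat{\mathbf Q}^{(0)}_w\hat{\mathbf Q}^{(0)\top}_w)$, $\hat{\boldsymbol\Lambda}^{(0)}_s=\sqrt N\hat{\mathbf Q}^{(0)}_s$ and $\hat{\mathbf F}^{(0)}_s=N^{-1}(\mathbf X^{(0)}-\hat{\mathbf F}^{(0)}_w\hat{\boldsymbol\Lambda}^{(0)\top}_w)\hat{\boldsymbol\Lambda}^{(0)}_s$. *)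

(* Defs.v *)
From HB Require Import structures.
From mathcomp Require Import all_boot all_order all_algebra.
From mathcomp Require Import all_classical all_reals all_analysis.
Set Implicit Arguments. Unset Strict Implicit. Unset Printing Implicit Defensive.
Import Order.TTheory GRing.Theory Num.Theory.
Local Open Scope classical_set_scope.
Local Open Scope ring_scope.

Section LinAlg.
Variable R : realType.

Definition fnorm m n (A : 'M[R]_(m, n)) : R :=
  Num.sqrt (\sum_(i < m) \sum_(j < n) (A i j) ^+ 2).

Definition specnorm m n (A : 'M[R]_(m, n)) : R :=
  sup ((fun x : 'cV[R]_n => fnorm (A *m x)) @` [set x | fnorm x = 1]).

Definition maxnorm m n (A : 'M[R]_(m, n)) : R :=
  \big[Num.max/0]_(i < m) \big[Num.max/0]_(j < n) `|A i j|.

Definition projP m n (A : 'M[R]_(m, n)) : 'M[R]_m :=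
  A *m invmx (A^T *m A) *m A^T.

Definition leading_eigvecs m r (S : 'M[R]_m) (Q : 'M[R]_(m, r)) : Prop :=
  Q^T *m Q = 1%:M /\
  exists lam : 'rV[R]_r,
    S *m Q = Q *m diag_mx lam /\
    (forall i j : 'I_r, (i <= j)%N -> lam 0 j <= lam 0 i) /\
    (forall (v : 'cV[R]_m) (mu : R), v != 0 -> Q^T *m v = 0 ->
        S *m v = mu *: v -> forall j : 'I_r, mu <= lam 0 j).

Definition posdef r (S : 'M[R]_r) : Prop :=
  S^T = S /\ forall x : 'cV[R]_r, x != 0 -> 0 < (x^T *m S *m x) 0 0.

Definition distinct_eigs r (S : 'M[R]_r) : Prop :=
  forall a : R, (\rank (eigenspace S a) <= 1)%N.

Definition tends0 (u : nat -> R) : Prop :=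
  forall e : R, 0 < e -> exists n0, forall n, (n0 <= n)%N -> `|u n| <= e.

Definition diverges (u : nat -> nat) : Prop :=
  forall M : nat, exists n0, forall n, (n0 <= n)%N -> (M <= u n)%N.

Definition same_order (a b : nat -> R) : Prop :=
  exists c C : R, 0 < c /\ 0 < C /\
    exists n0, forall n, (n0 <= n)%N -> c * b n <= a n /\ a n <= C * b n.

End LinAlg.

Section Prob.
Variables (R : realType) (d : measure_display) (Omega : measurableType d)
          (P : probability Omega R).

(* X_n = O_p(a_n): for every e > 0 there is M > 0 such that for large n,
   P(|X_n| > M a_n) < e (outer probability, so that no measurability of the
   event is presupposed). *)
Definition Op (X : nat -> Omega -> R) (a : nat -> R) : Prop :=
  forall e : R, 0 < e -> exists M : R, 0 < M /\
    exists n0, forall n, (n0 <= n)%N ->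
      exists A, measurable A /\ [set w | M * a n < `|X n w|] `<=` A /\
                (P A < e%:E)%E.

Definition cvg_in_prob (p q : nat) (Y : nat -> Omega -> 'M[R]_(p, q))
  (L : 'M[R]_(p, q)) : Prop :=
  forall e delta : R, 0 < e -> 0 < delta ->
    exists n0, forall n, (n0 <= n)%N ->
      exists A, measurable A /\ [set w | e < specnorm (Y n w - L)] `<=` A /\
                (P A < delta%:E)%E.

Definition rand_mx (p q : nat -> nat) (Y : forall n, Omega -> 'M[R]_(p n, q n))
  : Prop :=
  forall n (i : 'I_(p n)) (j : 'I_(q n)),
    measurable_fun setT (fun w => Y n w i j).

Definition Expect (X : Omega -> R) : \bar R := (\int[P]_w (X w)%:E)%E.

End Prob.

Lemma pred_lt_self (s : nat) : (0 < s)%N -> (s.-1 < s)%N.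
Proof. by move=> h; rewrite ltn_predL. Qed.

Definition ord_first (s : nat) (hs : (0 < s)%N) : 'I_s := Ordinal hs.
Definition ord_last (s : nat) (hs : (0 < s)%N) : 'I_s := Ordinal (pred_lt_self hs).

(* Main.v *)
(** Each panel is X = F L^T + E. If Q collects its leading eigenvectors, then
    (1 - P_L) Q diag(lam) is (1 - P_L) (E^T F L^T + E^T E) Q up to scaling,
    because 1 - P_L kills L. A Rayleigh quotient argument on the range of L
    bounds the eigenvalues below by a multiple of the factor strength g
    (N^alpha_s for the target, where (A6)(1) makes the cross term negligible,
    and N for the sources), so |Q Q^T - P_L| = O_p(N / (sqrt T g) + 1 / g).

    The weighted average of these projections is P_w + S up to an error of the
    order of the rate, where S P_w is of that order too and |S| <= 1 - kappa;
    the spectral gap kappa then bounds D = |(1 - P_w) Q_w| by the rate. With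
    H = (Lw^T Lw)^-1 Lw^T Q_w D_w^(1/2), the loading error is
    (1 - P_w) Q_w D_w^(1/2), and the inverse transpose of H is
    Lw^T V D_w^(-1/2) with V = P_w Q_w (Q_w^T P_w Q_w)^-1 at distance O(D) from
    Q_w.

    The rate need not tend to 0, since eps is arbitrary. When D > 1/2 the rate
    is bounded below, and H = 1 satisfies both estimates trivially. *)

Require Import Defs.
From HB Require Import structures.
From mathcomp Require Import all_boot all_order all_algebra.
From mathcomp Require Import all_classical all_reals all_analysis.
From mathcomp Require Import measurable_realfun.
From mathcomp Require Import ring lra.
Set Implicit Arguments.
Unset Strict Implicit.
Unset Printing Implicit Defensive.
Import Order.TTheory GRing.Theory Num.Theory.
Import numFieldNormedType.Exports.
Local Open Scope classical_set_scope.
Local Open Scope ring_scope.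

(** * Frobenius and spectral norms *)

(** Frobenius norms carry most of the argument: the numbers of factors are fixed, so an orthonormal
    frame costs only a constant such as [r + 1]. Spectral norms stay where the assumptions speak of
    nothing else: the errors, the Gram deviations and the residual part [S] of the average.

    Only projections are compared across panels, never frames, so no rotation has to be aligned
    until H is built.

    Probability is confined to exceptional events. Off one such event all estimates are
    deterministic linear algebra with a single constant. The order of choices matters: the event
    fixes the constant, and only then is the index chosen from which (A6)(1) beats that constant.

    The theorem asks for an invertible H at every index and outcome, including those where the weak
    loadings are degenerate or the perturbation is large. Hence H is defined by a test with a
    default value, and both branches of the test must meet the same bounds. *)

Section Frobenius.
Context {R : realType}.

Lemma le_of_sqr (x y : R) : 0 <= y -> x ^+ 2 <= y ^+ 2 -> x <= y.
Proof. by move=> y0 xy; rewrite leNgt; apply/negP => yx; nra. Qed.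

Lemma sqr_le (x y : R) : 0 <= x -> x <= y -> x ^+ 2 <= y ^+ 2.
Proof. by move=> x0 xy; nra. Qed.

Lemma addmxE m n (A B : 'M[R]_(m, n)) i j : (A + B) i j = A i j + B i j.
Proof. by rewrite mxE. Qed.

Lemma oppmxE m n (A : 'M[R]_(m, n)) i j : (- A) i j = - A i j.
Proof. by rewrite mxE. Qed.

Lemma scalemxE m n a (A : 'M[R]_(m, n)) i j : (a *: A) i j = a * A i j.
Proof. by rewrite mxE. Qed.

Lemma mxtrace_trmulE m n (A B : 'M[R]_(m, n)) :
  \tr (A^T *m B) = \sum_i \sum_j A i j * B i j.
Proof.
rewrite /mxtrace exchange_big /=; apply: eq_bigr => j _; rewrite mxE.
by apply: eq_bigr => i _; rewrite mxE.
Qed.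

Lemma fnorm_ge0 m n (A : 'M[R]_(m, n)) : 0 <= fnorm A.
Proof. exact: sqrtr_ge0. Qed.

Lemma fnorm_sqr m n (A : 'M[R]_(m, n)) : fnorm A ^+ 2 = \tr (A^T *m A).
Proof.
rewrite mxtrace_trmulE sqr_sqrtr; last first.
  by apply: sumr_ge0 => i _; apply: sumr_ge0 => j _; exact: sqr_ge0.
by apply: eq_bigr => i _; apply: eq_bigr => j _; rewrite expr2.
Qed.

Lemma fnorm_sqrE m n (A : 'M[R]_(m, n)) :
  fnorm A ^+ 2 = \sum_i \sum_j A i j ^+ 2.
Proof.
rewrite sqr_sqrtr //.
by apply: sumr_ge0 => i _; apply: sumr_ge0 => j _; exact: sqr_ge0.
Qed.

Lemma fnorm_sqr_cV n (v : 'cV[R]_n) : fnorm v ^+ 2 = (v^T *m v) 0 0.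
Proof. by rewrite fnorm_sqr /mxtrace big_ord1. Qed.

Lemma fnorm_eq0 m n (A : 'M[R]_(m, n)) : fnorm A = 0 -> A = 0.
Proof.
move=> A0; apply/matrixP => i j; rewrite mxE.
have : fnorm A ^+ 2 = 0 by rewrite A0 expr0n.
rewrite fnorm_sqrE => /eqP; rewrite psumr_eq0; last first.
  by move=> k _; apply: sumr_ge0 => l _; exact: sqr_ge0.
move=> /allP /(_ i); rewrite mem_index_enum => /(_ isT) /=.
rewrite psumr_eq0; last by move=> k _; exact: sqr_ge0.
move=> /allP /(_ j); rewrite mem_index_enum => /(_ isT) /=.
by rewrite sqrf_eq0 => /eqP.
Qed.

Lemma fnorm0 m n : fnorm (0 : 'M[R]_(m, n)) = 0.
Proof.
by apply/eqP; rewrite -sqrf_eq0 fnorm_sqr trmx0 mul0mx mxtrace0.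
Qed.

Lemma fnorm_gt0 m n (A : 'M[R]_(m, n)) : A != 0 -> 0 < fnorm A.
Proof.
move=> A0; rewrite lt_def fnorm_ge0 andbT.
by apply: contra A0 => /eqP /fnorm_eq0 ->.
Qed.

Lemma fnormZ m n a (A : 'M[R]_(m, n)) : fnorm (a *: A) = `|a| * fnorm A.
Proof.
apply/eqP; rewrite -(eqrXn2 (n := 2)) ?fnorm_ge0 ?mulr_ge0 ?fnorm_ge0 //.
rewrite exprMn !fnorm_sqr real_normK ?num_real //.
by rewrite [(a *: A)^T]linearZ /= -scalemxAl -scalemxAr scalerA linearZ.
Qed.

Lemma fnormN m n (A : 'M[R]_(m, n)) : fnorm (- A) = fnorm A.
Proof. by rewrite -scaleN1r fnormZ normrN1 mul1r. Qed.

Lemma fnorm_trmx m n (A : 'M[R]_(m, n)) : fnorm A^T = fnorm A.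
Proof.
apply/eqP; rewrite -(eqrXn2 (n := 2)) ?fnorm_ge0 //.
by rewrite !fnorm_sqr trmxK mxtrace_mulC.
Qed.

Lemma fnorm_sqr_rV n (v : 'rV[R]_n) : fnorm v ^+ 2 = (v *m v^T) 0 0.
Proof. by rewrite -fnorm_trmx fnorm_sqr_cV trmxK. Qed.

Lemma mxtrace_trmulC m n (A B : 'M[R]_(m, n)) :
  \tr (A^T *m B) = \tr (B^T *m A).
Proof. by rewrite -mxtrace_tr trmx_mul trmxK. Qed.

Lemma fnorm_sqrD m n (A B : 'M[R]_(m, n)) :
  fnorm (A + B) ^+ 2 = fnorm A ^+ 2 + 2 * \tr (A^T *m B) + fnorm B ^+ 2.
Proof.
rewrite !fnorm_sqr [(A + B)^T]linearD /= mulmxDl !mulmxDr !linearD /=.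
rewrite (mxtrace_trmulC B A); ring.
Qed.

(** Cauchy-Schwarz for the trace inner product, from the nonnegative square of [b^2 A - c B] with
    [b = fnorm B] and [c] the inner product: the residual of projecting [A] on [B], cleared of
    denominators. *)
Lemma mxtrace_trmul_le m n (A B : 'M[R]_(m, n)) :
  \tr (A^T *m B) <= fnorm A * fnorm B.
Proof.
have [-> | B0] := eqVneq B 0; first by rewrite mulmx0 mxtrace0 fnorm0 mulr0.
set c := \tr _; have := fnorm_ge0 A; have b0 := fnorm_gt0 B0.
have := fnorm_sqrD (fnorm B ^+ 2 *: A) (- c *: B).
rewrite [(_ *: A)^T]linearZ /= -scalemxAl -scalemxAr !linearZ /= -/c !fnormZ.
rewrite !exprMn !real_normK ?num_real //.
have := sqr_ge0 (fnorm (fnorm B ^+ 2 *: A + - c *: B)).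
move=> h1 /(fun h => eq_ind _ (fun x => 0 <= x) h1 _ h).
set a := fnorm A; set b := fnorm B => h a0.
have {}h : 0 <= b ^+ 2 * ((a * b) ^+ 2 - c ^+ 2).
  by apply: le_trans h _; rewrite le_eqVlt; apply/orP; left; apply/eqP; ring.
rewrite pmulr_rge0 ?exprn_gt0 // subr_ge0 in h.
have [c0|c0] := leP c 0; first by apply: le_trans c0 _; rewrite mulr_ge0 // ltW.
by apply: le_of_sqr => //; rewrite mulr_ge0 // ltW.
Qed.

Lemma fnormD m n (A B : 'M[R]_(m, n)) : fnorm (A + B) <= fnorm A + fnorm B.
Proof.
apply: le_of_sqr; first by rewrite addr_ge0 ?fnorm_ge0.
rewrite fnorm_sqrD; have := mxtrace_trmul_le A B; nra.
Qed.

Lemma fnormB m n (A B : 'M[R]_(m, n)) : fnorm (A - B) <= fnorm A + fnorm B.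
Proof. by rewrite -(fnormN B); exact: fnormD. Qed.

Lemma fnorm_sum m n (I : finType) (F : I -> 'M[R]_(m, n)) :
  fnorm (\sum_i F i) <= \sum_i fnorm (F i).
Proof.
elim/big_ind2 : _ => [|A a B b lA lB|//]; first by rewrite fnorm0.
by apply: le_trans (fnormD _ _) _; exact: lerD.
Qed.

Lemma fnorm_cols m n (A : 'M[R]_(m, n)) :
  fnorm A ^+ 2 = \sum_j fnorm (col j A) ^+ 2.
Proof.
rewrite fnorm_sqrE exchange_big /=; apply: eq_bigr => j _.
rewrite fnorm_sqrE; apply: eq_bigr => i _.
by rewrite big_ord1 mxE.
Qed.

Lemma fnorm_rows m n (A : 'M[R]_(m, n)) :
  fnorm A ^+ 2 = \sum_i fnorm (row i A) ^+ 2.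
Proof.
rewrite fnorm_sqrE; apply: eq_bigr => j _.
rewrite fnorm_sqrE big_ord1; apply: eq_bigr => i _.
by rewrite mxE.
Qed.

(** The columns of [B] can be treated one by one, as their squared lengths add up. Taking [c] to be
    the Frobenius or the spectral norm of [A] yields both product bounds below. *)
Lemma fnormM_op m n p c (A : 'M[R]_(m, n)) (B : 'M[R]_(n, p)) : 0 <= c ->
  (forall x : 'cV[R]_n, fnorm (A *m x) <= c * fnorm x) ->
  fnorm (A *m B) <= c * fnorm B.
Proof.
move=> c0 Ac; apply: le_of_sqr; first by rewrite ?mulr_ge0 ?fnorm_ge0.
rewrite exprMn !fnorm_cols mulr_sumr; apply: ler_sum => j _.
rewrite -exprMn; apply: sqr_le; first exact: fnorm_ge0.
by rewrite colE -mulmxA -colE.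
Qed.

Lemma fnormM m n p (A : 'M[R]_(m, n)) (B : 'M[R]_(n, p)) :
  fnorm (A *m B) <= fnorm A * fnorm B.
Proof.
apply: fnormM_op => [|x]; first exact: fnorm_ge0.
apply: le_of_sqr; first by rewrite ?mulr_ge0 ?fnorm_ge0.
rewrite exprMn (fnorm_rows (A *m x)) fnorm_rows mulr_suml.
apply: ler_sum => i _; rewrite row_mul.
rewrite fnorm_sqrE !big_ord1 -exprMn.
have -> : (row i A *m x) 0 0 = \tr ((row i A)^T^T *m x).
  by rewrite trmxK /mxtrace big_ord1.
have h := mxtrace_trmul_le (row i A)^T x.
have h' := mxtrace_trmul_le (row i A)^T (- x).
rewrite mulmxN linearN /= fnormN in h'.
rewrite fnorm_trmx in h h'.
rewrite -real_normK ?num_real //; apply: sqr_le => //.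
by rewrite ler_norml lerNl h h'.
Qed.

Lemma specnorm_has_sup m n (A : 'M[R]_(m, n)) :
  has_ubound ((fun x : 'cV[R]_n => fnorm (A *m x)) @` [set x | fnorm x = 1]).
Proof.
exists (fnorm A) => _ [x /= x1 <-].
by apply: le_trans (fnormM _ _) _; rewrite x1 mulr1.
Qed.

Lemma specnorm_ge0 m n (A : 'M[R]_(m, n)) : 0 <= specnorm A.
Proof.
rewrite /specnorm; set S := _ @` _.
have [[y Sy]|S0] := pselect (S !=set0).
  apply: (@le_trans _ _ y); first by case: Sy => x _ <-; exact: fnorm_ge0.
  by apply: ub_le_sup Sy; exact: specnorm_has_sup.
(* The unit sphere is empty when [n = 0], and the supremum is then 0 by default. *)
rewrite (_ : S = set0) ?sup0 //.
by apply/eqP/negPn/negP => /set0P.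
Qed.

Lemma specnorm_le m n (A : 'M[R]_(m, n)) c : 0 <= c ->
  (forall x : 'cV[R]_n, fnorm (A *m x) <= c * fnorm x) -> specnorm A <= c.
Proof.
move=> c0 Ac; rewrite /specnorm; set S := _ @` _.
have [S0|S0] := pselect (S !=set0).
  apply: ge_sup => // _ [x /= x1 <-].
  by apply: le_trans (Ac _) _; rewrite x1 mulr1.
rewrite (_ : S = set0) ?sup0 //.
by apply/eqP/negPn/negP => /set0P.
Qed.

Lemma specnorm_le_fnorm m n (A : 'M[R]_(m, n)) : specnorm A <= fnorm A.
Proof. by apply: specnorm_le => [|x]; [exact: fnorm_ge0|exact: fnormM]. Qed.

Lemma fnormM_spec m n p (A : 'M[R]_(m, n)) (B : 'M[R]_(n, p)) :
  fnorm (A *m B) <= specnorm A * fnorm B.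
Proof.
apply: fnormM_op => [|x]; first exact: specnorm_ge0.
have [->|x0] := eqVneq x 0; first by rewrite mulmx0 !fnorm0 mulr0.
have n0 := fnorm_gt0 x0.
rewrite -ler_pdivrMr // mulrC -[_^-1]ger0_norm ?invr_ge0 ?(ltW n0) //.
rewrite -fnormZ scalemxAr; apply: (ub_le_sup (specnorm_has_sup A) (ex_intro2 _ _
  ((fnorm x)^-1 *: x) _ erefl)) => /=.
by rewrite fnormZ ger0_norm ?invr_ge0 ?(ltW n0) // mulVf // gt_eqF.
Qed.

Lemma specnormZ_le m n a (A : 'M[R]_(m, n)) : 0 <= a ->
  specnorm (a *: A) <= a * specnorm A.
Proof.
move=> a0; apply: specnorm_le => [|x]; first by rewrite mulr_ge0 ?specnorm_ge0.
rewrite -scalemxAl fnormZ ger0_norm // -mulrA ler_wpM2l //.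
exact: fnormM_spec.
Qed.

Lemma fnorm_diag_mulr_le m n (A : 'M[R]_(m, n)) (u : 'rV[R]_n) c : 0 <= c ->
  (forall j, `|u 0 j| <= c) -> fnorm (A *m diag_mx u) <= c * fnorm A.
Proof.
move=> c0 uc; apply: le_of_sqr; first by rewrite ?mulr_ge0 ?fnorm_ge0.
rewrite exprMn !fnorm_sqrE mulr_sumr; apply: ler_sum => i _.
rewrite mulr_sumr; apply: ler_sum => j _.
rewrite mul_mx_diag mxE exprMn mulrC ler_wpM2r ?sqr_ge0 //.
by rewrite -(real_normK (num_real (u 0 j))); apply: sqr_le.
Qed.

Lemma fnorm_diag_mulr_ge m n (A : 'M[R]_(m, n)) (u : 'rV[R]_n) c : 0 <= c ->
  (forall j, c <= `|u 0 j|) -> c * fnorm A <= fnorm (A *m diag_mx u).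
Proof.
move=> c0 uc; apply: le_of_sqr; first by rewrite ?mulr_ge0 ?fnorm_ge0.
rewrite exprMn !fnorm_sqrE mulr_sumr; apply: ler_sum => i _.
rewrite mulr_sumr; apply: ler_sum => j _.
rewrite mul_mx_diag mxE exprMn [leRHS]mulrC ler_wpM2r ?sqr_ge0 //.
by rewrite -(real_normK (num_real (u 0 j))); apply: sqr_le.
Qed.

Lemma fnorm_diag_mull_ge m n (A : 'M[R]_(m, n)) (u : 'rV[R]_m) c : 0 <= c ->
  (forall j, c <= `|u 0 j|) -> c * fnorm A <= fnorm (diag_mx u *m A).
Proof.
move=> c0 uc; rewrite -[fnorm A]fnorm_trmx -[leRHS]fnorm_trmx trmx_mul tr_diag_mx.
exact: fnorm_diag_mulr_ge.
Qed.

Lemma fnorm_orthonormal m n (Q : 'M[R]_(m, n)) :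
  Q^T *m Q = 1%:M -> fnorm Q ^+ 2 = n%:R.
Proof. by rewrite fnorm_sqr => ->; rewrite mxtrace1. Qed.

Lemma fnorm_row_mx m n p (A : 'M[R]_(m, n)) (B : 'M[R]_(m, p)) :
  fnorm (row_mx A B) ^+ 2 = fnorm A ^+ 2 + fnorm B ^+ 2.
Proof.
by rewrite !fnorm_sqr tr_row_mx mul_col_row mxtrace_block.
Qed.

End Frobenius.

(** * Projections and Rayleigh quotients *)

Section Projections.
Context {R : realType}.

Lemma gram_unitmx m n (A : 'M[R]_(m, n)) :
  (forall y : 'cV[R]_n, A *m y = 0 -> y = 0) -> A^T *m A \in unitmx.
Proof.
move=> Ainj; rewrite unitmxE unitfE; apply/det0P => -[v v0 vA].
have : A *m v^T = 0.
  apply: fnorm_eq0; apply/eqP; rewrite -sqrf_eq0 fnorm_sqr trmx_mul trmxK.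
  by rewrite !mulmxA -(mulmxA v) vA mul0mx mxtrace0.
by move=> /Ainj /eqP; rewrite trmx_eq0 (negbTE v0).
Qed.

Lemma gram_unitmx_inj m n (A : 'M[R]_(m, n)) :
  A^T *m A \in unitmx -> forall y : 'cV[R]_n, A *m y = 0 -> y = 0.
Proof. by move=> Au y Ay; rewrite -(mulKmx Au y) -mulmxA Ay !mulmx0. Qed.

Definition orthproj m (A : 'M[R]_m) := A^T = A /\ A *m A = A.

Lemma orthproj_projP m n (A : 'M[R]_(m, n)) :
  A^T *m A \in unitmx -> orthproj (projP A).
Proof.
move=> Au; split; first by rewrite /projP !trmx_mul trmx_inv trmx_mul !trmxK mulmxA.
by rewrite /projP !mulmxA -(mulmxA _ A^T A) mulmxKV.
Qed.

Lemma projP_mul m n (A : 'M[R]_(m, n)) :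
  A^T *m A \in unitmx -> projP A *m A = A.
Proof. by move=> Au; rewrite /projP -mulmxA mulmxKV. Qed.

Lemma mxtrace_projP m n (A : 'M[R]_(m, n)) :
  A^T *m A \in unitmx -> \tr (projP A) = n%:R.
Proof.
by move=> Au; rewrite /projP mxtrace_mulC !mulmxA mulmxV // mxtrace1.
Qed.

Lemma orthproj_compl m (A : 'M[R]_m) : orthproj A -> orthproj (1%:M - A).
Proof.
move=> [At Ai]; split; first by rewrite linearB /= trmx1 At.
by rewrite mulmxBl mul1mx mulmxBr mulmx1 Ai subrr subr0.
Qed.

Lemma orthproj_orthonormal m n (Q : 'M[R]_(m, n)) :
  Q^T *m Q = 1%:M -> orthproj (Q *m Q^T).
Proof.
move=> QQ; split; first by rewrite trmx_mul trmxK.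
by rewrite mulmxA -(mulmxA Q) QQ mulmx1.
Qed.

Lemma fnorm_orthproj m n (A : 'M[R]_m) (B : 'M[R]_(m, n)) : orthproj A ->
  fnorm (A *m B) ^+ 2 = \tr (B^T *m A *m B).
Proof.
by move=> [At Ai]; rewrite fnorm_sqr trmx_mul At !mulmxA -(mulmxA _ A A) Ai.
Qed.

Lemma fnorm_orthproj_split m n (A : 'M[R]_m) (B : 'M[R]_(m, n)) : orthproj A ->
  fnorm B ^+ 2 = fnorm (A *m B) ^+ 2 + fnorm ((1%:M - A) *m B) ^+ 2.
Proof.
move=> Ap; rewrite !fnorm_orthproj //; last exact: orthproj_compl.
by rewrite mulmxBr mulmxBl mulmx1 linearB /= addrC subrK fnorm_sqr.
Qed.

Lemma fnorm_orthproj_le m n (A : 'M[R]_m) (B : 'M[R]_(m, n)) : orthproj A ->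
  fnorm (A *m B) <= fnorm B.
Proof.
move=> Ap; apply: le_of_sqr; first exact: fnorm_ge0.
by rewrite (fnorm_orthproj_split B Ap) lerDl sqr_ge0.
Qed.

(** Both projections have trace [r], so each side equals [2 r - 2 tr (Q^T A Q)]. This replaces any
    alignment of bases. *)
Lemma orthproj_dist m r (A : 'M[R]_m) (Q : 'M[R]_(m, r)) :
  orthproj A -> \tr A = r%:R -> Q^T *m Q = 1%:M ->
  fnorm (Q *m Q^T - A) ^+ 2 = 2 * fnorm ((1%:M - A) *m Q) ^+ 2.
Proof.
move=> Ap trA QQ; have Qp := orthproj_orthonormal QQ.
rewrite (fnorm_orthproj _ (orthproj_compl Ap)) fnorm_sqr.
rewrite (mulmxBr Q^T) (mulmxBl _ _ Q) mulmx1 QQ [\tr (1%:M - _)]linearB /= mxtrace1.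
rewrite [(_ - A)^T]linearB /= Ap.1 Qp.1 mulmxBl !mulmxBr Qp.2 Ap.2 !linearB /=.
rewrite trA (mxtrace_mulC A) (mxtrace_mulC Q) QQ mxtrace1.
have -> : \tr (Q *m Q^T *m A) = \tr (Q^T *m A *m Q).
  by rewrite -mulmxA mxtrace_mulC.
ring.
Qed.

(** Idempotence of the sum gives [A B = - B A]; multiplying by [A] then gives [A B = B A]. This
    recovers orthogonality of loading blocks from the assumed decomposition of their joint
    projection. *)
Lemma orthproj_add_orth m (A B : 'M[R]_m) :
  orthproj A -> orthproj B -> orthproj (A + B) -> A *m B = 0.
Proof.
move=> [_ Ai] [_ Bi] [_].
rewrite mulmxDl !mulmxDr Ai Bi => /eqP.
rewrite -addrA (inj_eq (addrI A)) addrA -[X in _ == X]add0r.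
rewrite (inj_eq (addIr B)) addr_eq0 => /eqP AB.
have AB2 : A *m B = B *m A.
  by rewrite -[in LHS]Ai -mulmxA AB mulmxN mulmxA AB mulNmx opprK -mulmxA Ai.
apply/matrixP => i j; move/matrixP: AB => /(_ i j).
by rewrite AB2 !mxE; lra.
Qed.

End Projections.

Section Rayleigh.
Context {R : realType}.

(** The unit sphere of the left kernel of [Q] is closed and bounded, hence compact. Row vectors are
    the shape that [EVT_max_rV] takes. *)
Lemma quad_attains_max n p (S : 'M[R]_n) (Q : 'M[R]_(n, p)) (x : 'rV[R]_n) :
  x *m Q = 0 -> fnorm x = 1 ->
  exists c : 'rV[R]_n, [/\ c *m Q = 0, fnorm c = 1 &
    forall t : 'rV[R]_n, t *m Q = 0 -> fnorm t = 1 ->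
      (t *m S *m t^T) 0 0 <= (c *m S *m c^T) 0 0].
Proof.
move=> xQ x1.
have cc i : continuous (fun v : 'rV[R]_n => v 0 i) by exact: coord_continuous.
have sumc k (f : 'I_k -> 'rV[R]_n -> R) :
    (forall i, continuous (f i)) -> continuous (fun v => \sum_i f i v).
  move=> fc v; rewrite (_ : (fun v => _) = \sum_i f i); last first.
    by apply/funext => w; rewrite fct_sumE.
  by apply: (big_ind (fun g => {for v, continuous g})) => [|g h|i _];
    [exact: cst_continuous|exact: continuousD|exact: fc].
have quadc (B : 'M[R]_n) :
    continuous (fun v : 'rV[R]_n => (v *m B *m v^T) 0 0).
  rewrite (_ : (fun v => _) = fun v : 'rV[R]_n => \sum_i (\sum_j v 0 j * B j i) * v 0 i).
    apply: (sumc) => i v; apply: continuousM; last exact: cc.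
    apply: (sumc) => j {}v; apply: continuousM; first exact: cc.
    exact: cst_continuous.
  apply/funext => v; rewrite mxE; apply: eq_bigr => i _; rewrite !mxE //.
pose A := [set v : 'rV[R]_n | v *m Q = 0 /\ fnorm v = 1].
have Acl : closed A.
  have -> : A = (\bigcap_(j : 'I_p) [set v : 'rV[R]_n | \sum_i v 0 i * Q i j \in [set 0
    : R]]) `&`
     [set v : 'rV[R]_n | (v *m 1%:M *m v^T) 0 0 \in [set 1 : R]].
    apply/seteqP; split=> v /=.
      move=> [vQ v1]; split.
        by move=> j _; rewrite /= inE /=; move/rowP: vQ => /(_ j); rewrite !mxE.
      by rewrite inE /= mulmx1 -fnorm_sqr_rV v1 expr1n.
    move=> [vQ v1]; split.
      apply/rowP => j; have := vQ j I.
      by rewrite /= inE /= !mxE.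
    move: v1; rewrite inE /= mulmx1 => v1.
    apply/eqP; rewrite -(eqrXn2 (n := 2)) ?fnorm_ge0 // expr1n.
    by rewrite fnorm_sqr_rV v1.
  apply: closedI.
    apply: closed_bigI => j _.
    rewrite (_ : [set v | _] = (fun v : 'rV[R]_n => \sum_i v 0 i * Q i j) @^-1` [set
      0]); last first.
      by apply/seteqP; split => v /=; rewrite inE.
    apply: closed_comp; last exact: closed_eq.
    move=> v _; apply: (sumc) => i {}v; apply: continuousM; [exact: cc|exact:
      cst_continuous].
  rewrite (_ : [set v | _] = (fun v : 'rV[R]_n => (v *m 1%:M *m v^T) 0 0) @^-1` [set
    1]); last first.
    by apply/seteqP; split => v /=; rewrite inE.
  apply: closed_comp; last exact: closed_eq.
  by move=> v _; exact: quadc.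
have Acp : compact A.
  apply: bounded_closed_compact => //.
  exists 1; split; first exact: num_real.
  move=> M M1 v [_ v1] /=; apply: le_trans (ltW M1).
  rewrite [leLHS]/Num.norm /= mx_normrE; apply/bigmax_leP; split => // -[i j] _ /=.
  rewrite (ord1 i) -v1; apply: le_of_sqr; first exact: fnorm_ge0.
  rewrite real_normK ?num_real // fnorm_sqrE big_ord1 (bigD1 j) //= lerDl.
  by apply: sumr_ge0 => k _; exact: sqr_ge0.
have A0 : A !=set0 by exists x.
have [c cA cmax] := EVT_max_rV A0 Acp (continuous_subspaceT (quadc S)).
move: cA; rewrite inE => -[cQ c1]; exists c; split => // t tQ t1.
by apply: cmax; rewrite inE.
Qed.

(** First-order condition at a constrained maximum. The residual [w] stays in the left kernel of
    [Q], so [c + t w] is admissible; maximality gives [0 <= 2 t a + t^2 b] for all [t], where [a] is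
    the squared norm of [w], and so [a = 0]. *)
Lemma quad_max_eigen n p (S : 'M[R]_n) (Q : 'M[R]_(n, p)) (c : 'rV[R]_n) m :
  S^T = S -> (forall t : 'rV[R]_n, t *m Q = 0 -> t *m S *m Q = 0) ->
  c *m Q = 0 -> (c *m S *m c^T) 0 0 = m * fnorm c ^+ 2 ->
  (forall t : 'rV[R]_n, t *m Q = 0 -> (t *m S *m t^T) 0 0 <= m * fnorm t ^+ 2) ->
  c *m S = m *: c.
Proof.
move=> St SQ cQ cm Sm; set w := m *: c - c *m S.
have wQ : w *m Q = 0 by rewrite mulmxBl -scalemxAl cQ scaler0 SQ // subr0.
suff : w = 0 by move/eqP; rewrite subr_eq0 => /eqP.
pose a := fnorm w ^+ 2; pose b := m * a - (w *m S *m w^T) 0 0.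
have b0 : 0 <= b by rewrite subr_ge0 Sm.
have nE := @fnorm_sqr_rV R n.
have sym (u v : 'rV[R]_n) : (v *m u^T) 0 0 = (u *m v^T) 0 0.
  by have -> : v *m u^T = (u *m v^T)^T; [rewrite trmx_mul trmxK|rewrite mxE].
have cw : m * (c *m w^T) 0 0 - (c *m S *m w^T) 0 0 = a.
  by rewrite /a nE {2}/w mulmxBl -scalemxAl !mxE.
have key t : 0 <= 2 * t * a + t ^+ 2 * b.
  have := Sm (c + t *: w); rewrite mulmxDl cQ -scalemxAl wQ scaler0 addr0.
  move=> /(_ erefl); rewrite -subr_ge0 nE.
  rewrite [(c + _)^T]linearD /= linearZ /= !mulmxDl !mulmxDr -!scalemxAl -!scalemxAr.
  have -> : (w *m S *m c^T) = (c *m S *m w^T)^T.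
    by rewrite !trmx_mul trmxK St mulmxA.
  have -> : (w *m c^T) = (c *m w^T)^T by rewrite trmx_mul trmxK.
  move: cm cw; rewrite nE /b !addmxE !scalemxE !(@mxE _ _ _ trmx_key) => -> cw.
  rewrite -!nE -/a; have -> : (c *m S *m w^T) 0 0 = m * (c *m w^T) 0 0 - a by lra.
  move=> h; lra.
have a0 : 0 <= a by exact: sqr_ge0.
have b1 : 0 < b + 1 by rewrite ltr_wpDl.
(* Dividing by [b + 1] instead of [b] keeps the value of the quadratic negative for [a != 0] and
   covers [b = 0]. *)
have := key (- a / (b + 1)); clear key Sm cw.
have -> : 2 * (- a / (b + 1)) * a + (- a / (b + 1)) ^+ 2 * b =
   - (a ^+ 2 * (b + 2) / (b + 1) ^+ 2) by field; rewrite gt_eqF.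
rewrite oppr_ge0 pmulr_lle0 ?invr_gt0 ?exprn_gt0 //.
move=> h; apply: fnorm_eq0; apply/eqP; rewrite -sqrf_eq0 -/a.
by rewrite -sqrf_eq0 eq_le sqr_ge0 andbT; move: h; rewrite pmulr_lle0 //; lra.
Qed.

(** [leading_eigvecs] only constrains eigenvectors orthogonal to [Q]. The maximiser of the form on
    that subspace is itself an eigenvector, so the constraint extends to the whole subspace. *)
Lemma rayleigh_le n p (S : 'M[R]_n) (Q : 'M[R]_(n, p)) m : S^T = S ->
  (forall t : 'rV[R]_n, t *m Q = 0 -> t *m S *m Q = 0) ->
  (forall (t : 'rV[R]_n) mu, t != 0 -> t *m Q = 0 -> t *m S = mu *: t -> mu <= m) ->
  forall t : 'rV[R]_n, t *m Q = 0 -> (t *m S *m t^T) 0 0 <= m * fnorm t ^+ 2.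
Proof.
move=> St SQ eigm t tQ.
have unit (v : 'rV[R]_n) : v != 0 -> fnorm ((fnorm v)^-1 *: v) = 1.
  move=> /fnorm_gt0 v0; rewrite fnormZ ger0_norm ?invr_ge0 ?ltW //.
  by rewrite mulVf // gt_eqF.
have scale (v : 'rV[R]_n) k : v != 0 ->
    (((fnorm v)^-1 *: v) *m S *m ((fnorm v)^-1 *: v)^T) 0 0 <= k ->
    (v *m S *m v^T) 0 0 <= k * fnorm v ^+ 2.
  move=> /fnorm_gt0 v0; rewrite linearZ /= -!scalemxAl -scalemxAr scalerA mxE.
  by rewrite -expr2 exprVn mulrC ler_pdivrMr ?exprn_gt0.
have [->|t0] := eqVneq t 0.
  by rewrite !mul0mx mxE fnorm0 expr0n mulr0.
have tQ' : (fnorm t)^-1 *: t *m Q = 0 by rewrite -scalemxAl tQ scaler0.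
have [c [cQ c1 cmax]] := quad_attains_max S tQ' (unit _ t0).
set m0 := (c *m S *m c^T) 0 0 in cmax.
have Sm0 (v : 'rV[R]_n) : v *m Q = 0 -> (v *m S *m v^T) 0 0 <= m0 * fnorm v ^+ 2.
  have [->|v0] := eqVneq v 0; first by rewrite !mul0mx mxE fnorm0 expr0n mulr0.
  move=> vQ; apply: scale => //; apply: cmax; last exact: unit.
  by rewrite -scalemxAl vQ scaler0.
have cS : c *m S = m0 *: c.
  by apply: (quad_max_eigen St SQ cQ _ Sm0); rewrite c1 expr1n mulr1.
apply: le_trans (Sm0 _ tQ) _; rewrite ler_wpM2r ?sqr_ge0 //.
apply: eigm cQ cS; apply: contraTneq (ltr01 : 0 < 1 :> R) => c0.
by rewrite -c1 c0 fnorm0 ltxx.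
Qed.

(** The constant is the minimum of the form on the unit sphere, reached as a maximum for [- S] under
    a constraint matrix with no columns. *)
Lemma posdef_lower n (S : 'M[R]_n) : posdef S ->
  exists2 c, 0 < c & forall x : 'cV[R]_n, c * fnorm x ^+ 2 <= (x^T *m S *m x) 0 0.
Proof.
move=> [St Spos].
have [[x x0]|nx] := pselect (exists x : 'rV[R]_n, x != 0); last first.
  exists 1 => // x; have -> : x = 0.
    apply/eqP/negPn/negP => x0; apply: nx; exists x^T.
    by rewrite trmx_eq0.
  by rewrite fnorm0 expr0n mulr0 mulmx0 mxE.
have unit (v : 'rV[R]_n) : v != 0 -> fnorm ((fnorm v)^-1 *: v) = 1.
  move=> /fnorm_gt0 v0; rewrite fnormZ ger0_norm ?invr_ge0 ?ltW //.
  by rewrite mulVf // gt_eqF.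
have q0 (v : 'rV[R]_n) : v *m (0 : 'M[R]_(n, 0)) = 0 by rewrite mulmx0.
have [c [_ c1 cmax]] := quad_attains_max (- S) (q0 _) (unit _ x0).
exists ((c *m S *m c^T) 0 0).
  have := Spos c^T; rewrite trmxK; apply; rewrite trmx_eq0.
  apply: contraTneq (ltr01 : 0 < 1 :> R) => c0.
  by rewrite -c1 c0 fnorm0 ltxx.
move=> v; have [->|v0] := eqVneq v 0.
  by rewrite fnorm0 expr0n mulr0 mulmx0 mxE.
have vt0 : v^T != 0 by rewrite trmx_eq0.
have := cmax _ (q0 _) (unit _ vt0).
rewrite linearZ /= trmxK -!scalemxAl -scalemxAr scalerA !mulmxN !mulNmx scalerN.
rewrite !oppmxE lerN2 scalemxE.
rewrite fnorm_trmx -expr2 exprVn => h.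
by rewrite -ler_pdivlMr ?exprn_gt0 ?fnorm_gt0 // mulrC.
Qed.

(** Courant-Fischer: the [r]-dimensional range of [A] contains a nonzero vector orthogonal to the
    first [r - 1] columns of [Q], and there the form is at most the last eigenvalue times the
    squared norm. *)
Lemma leading_eigvals_ge n r (S : 'M[R]_n) (Q A : 'M[R]_(n, r)) (lam : 'rV[R]_r) c :
  S^T = S -> Q^T *m Q = 1%:M -> S *m Q = Q *m diag_mx lam ->
  (forall i j : 'I_r, (i <= j)%N -> lam 0 j <= lam 0 i) ->
  (forall (v : 'cV[R]_n) (mu : R), v != 0 -> Q^T *m v = 0 ->
        S *m v = mu *: v -> forall j : 'I_r, mu <= lam 0 j) ->
  (forall y : 'cV[R]_r, A *m y = 0 -> y = 0) ->
  (forall y : 'cV[R]_r,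
     c * fnorm (A *m y) ^+ 2 <= ((A *m y)^T *m S *m (A *m y)) 0 0) ->
  forall j, c <= lam 0 j.
Proof.
case: r Q A lam => [|r] Q A lam St QQ SQ lamd lamv Ainj Ac j; first by case: j.
suff cl : c <= lam 0 ord_max by apply: le_trans cl _; apply: lamd; rewrite leq_ord.
(* With its last row cleared [Q^T A] is singular, and a kernel vector [y] makes [A y] orthogonal to
   every column of [Q] but the last. *)
pose B := \matrix_(i < r.+1, k < r.+1) (if i == ord_max then 0 else (Q^T *m A) i k).
have /eqP/det0P [y y0 By] : \det B^T = 0.
  rewrite det_tr (expand_det_row _ ord_max) big1 // => k _.
  by rewrite mxE eqxx mul0r.
pose x := A *m y^T.
have x0 : x != 0.
  by apply: contra y0 => /eqP /Ainj /eqP; rewrite trmx_eq0.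
have xQ (i : 'I_r.+1) : i != ord_max -> (Q^T *m x) i 0 = 0.
  move=> ni; move/rowP: By => /(_ i) h; rewrite !mxE in h.
  have -> : Q^T *m x = Q^T *m A *m y^T by rewrite mulmxA.
  rewrite mxE -[RHS]h; apply: eq_bigr => k _.
  by rewrite !mxE (negbTE ni) mulrC.
pose al := (Q^T *m x) ord_max 0; pose q := col ord_max Q; pose z := x - al *: q.
have QqE : Q^T *m q = col ord_max 1%:M by rewrite /q !colE mulmxA QQ mul1mx.
have Qz : Q^T *m z = 0.
  apply/matrixP => i k; rewrite (ord1 k) /z mulmxBr -scalemxAr QqE !mxE.
  have [->|ni] := eqVneq i ord_max.
    by rewrite mulr1 /al mxE subrr.
  by rewrite mulr0 subr0; have := xQ _ ni; rewrite mxE.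
have Sq : S *m q = lam 0 ord_max *: q.
  rewrite /q [in LHS]colE mulmxA -colE SQ mul_mx_diag; apply/matrixP => i k.
  by rewrite !mxE mulrC.
have qS : q^T *m S = lam 0 ord_max *: q^T.
  by rewrite -[LHS]trmxK trmx_mul trmxK St Sq linearZ.
have qz : q^T *m z = 0.
  by rewrite /q tr_col -row_mul Qz; apply/rowP => k; rewrite !mxE.
have zq : z^T *m q = 0 by rewrite -[LHS]trmxK trmx_mul trmxK qz trmx0.
have qq : q^T *m q = 1%:M.
  rewrite {1}/q tr_col -row_mul QqE; apply/matrixP => i k.
  by rewrite (ord1 i) (ord1 k) !mxE eqxx.
have xE : x = z + al *: q by rewrite subrK.
clearbody z.
have nE := @fnorm_sqr_cV R n.
have nx : fnorm x ^+ 2 = fnorm z ^+ 2 + al ^+ 2.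
  rewrite !nE xE [(z + _)^T]linearD /= [(_ *: q)^T]linearZ /= mulmxDl !mulmxDr
    -!scalemxAl -!scalemxAr.
  by rewrite qz zq qq !scaler0 addr0 add0r !mxE /= mulr1n mulr1 expr2.
have sx : (x^T *m S *m x) 0 0 = (z^T *m S *m z) 0 0 + lam 0 ord_max * al ^+ 2.
  rewrite xE [(z + _)^T]linearD /= [(_ *: q)^T]linearZ /= !mulmxDl !mulmxDr -!scalemxAl
    -!scalemxAr.
  rewrite -(mulmxA z^T S q) Sq qS -!scalemxAr -!scalemxAl qz zq qq !scaler0 addr0 add0r
    !mxE /= mulr1n.
  ring.
have ray : (z^T *m S *m z) 0 0 <= lam 0 ord_max * fnorm z ^+ 2.
  have := @rayleigh_le _ _ S Q (lam 0 ord_max) St _ _ z^T.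
  rewrite trmxK fnorm_trmx; apply.
  - by move=> t tQ; rewrite -mulmxA SQ mulmxA tQ mul0mx.
  - move=> t mu t0 tQ tS; apply: (lamv t^T); rewrite ?trmx_eq0 //.
      by rewrite -[LHS]trmxK trmx_mul !trmxK tQ trmx0.
    by rewrite -[LHS]trmxK trmx_mul !trmxK St tS linearZ.
  - by rewrite -[LHS]trmxK trmx_mul !trmxK Qz trmx0.
have := Ac y^T; rewrite -/x sx.
have := fnorm_gt0 x0; move=> x0' h.
have : c * fnorm x ^+ 2 <= lam 0 ord_max * fnorm x ^+ 2 by rewrite [in leRHS]nx; lra.
by rewrite ler_pM2r ?exprn_gt0.
Qed.

End Rayleigh.

(** * Eigenvector perturbation *)

Section Perturbation.
Context {R : realType}.

(** Pairing [A^T B] with itself moves the transpose onto [B], so the spectral norm of [A] serves for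
    [A^T] too. *)
Lemma fnormM_spec_tr m n p (A : 'M[R]_(m, n)) (B : 'M[R]_(m, p)) :
  fnorm (A^T *m B) <= specnorm A * fnorm B.
Proof.
have [->|h] := eqVneq (A^T *m B) 0.
  by rewrite fnorm0 mulr_ge0 ?specnorm_ge0 ?fnorm_ge0.
rewrite -(ler_pM2r (fnorm_gt0 h)) -expr2 fnorm_sqr trmx_mul trmxK -mulmxA.
apply: le_trans (mxtrace_trmul_le _ _) _.
rewrite mulrAC mulrC ler_wpM2r ?fnorm_ge0 //.
exact: fnormM_spec.
Qed.

Lemma cV_trmul_ge n (u v : 'cV[R]_n) a b : fnorm u <= a -> fnorm v <= b ->
  - (a * b) <= (u^T *m v) 0 0.
Proof.
move=> ua vb; have := mxtrace_trmul_le u (- v).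
rewrite fnormN mulmxN linearN /= /mxtrace big_ord1 => h.
rewrite lerNl; apply: le_trans h _; apply: ler_pM => //; exact: fnorm_ge0.
Qed.

Lemma orthonormal_fnormM m n p (Q : 'M[R]_(m, n)) (B : 'M[R]_(n, p)) :
  Q^T *m Q = 1%:M -> fnorm (Q *m B) = fnorm B.
Proof.
move=> QQ; apply/eqP; rewrite -(eqrXn2 (n := 2)) ?fnorm_ge0 //.
by rewrite !fnorm_sqr trmx_mul -mulmxA (mulmxA Q^T) QQ mul1mx.
Qed.

Lemma orthonormal_fnorm_le m n (Q : 'M[R]_(m, n)) :
  Q^T *m Q = 1%:M -> fnorm Q <= n%:R + 1.
Proof.
move=> QQ; apply: le_of_sqr; first by rewrite addr_ge0.
have n0 := ler0n R n; rewrite (fnorm_orthonormal QQ); nra.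
Qed.

(** Per unit of [fnorm x ^+ 2], the factor part contributes at least [T g / M^2] and the cross term
    removes at most [2 M N sqrt T]; the smallness hypothesis makes this at most half of the gain.
    The square of [E x] is dropped. *)
Lemma pca_quad_lower T r N (F : 'M[R]_(T, r)) (L : 'M[R]_(N, r))
    (E : 'M[R]_(T, N)) (M g : R) (x : 'cV[R]_N) :
  1 <= M -> 0 < g -> (0 < T)%N ->
  (forall y : 'cV[R]_r, M^-1 * T%:R * fnorm y ^+ 2 <= fnorm (F *m y) ^+ 2) ->
  fnorm (E^T *m F) ^+ 2 <= M * (N%:R * T%:R) ->
  fnorm L ^+ 2 <= M * N%:R ->
  M^-1 * g * fnorm x ^+ 2 <= fnorm (L^T *m x) ^+ 2 ->
  N%:R / (Num.sqrt T%:R * g) <= (4 * M ^+ 3)^-1 ->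
  T%:R * g / (2 * M ^+ 2) * fnorm x ^+ 2 <=
    fnorm ((F *m L^T + E) *m x) ^+ 2.
Proof.
move=> M1 g0 T0 HF HEF HL Hx Hs.
have M0 : 0 < M by lra.
have T0' : 0 < T%:R :> R by rewrite ltr0n.
have N0 : 0 <= N%:R :> R by [].
set st := Num.sqrt T%:R in Hs *.
have st0 : 0 < st by rewrite sqrtr_gt0.
have stE : T%:R = st ^+ 2 by rewrite sqr_sqrtr // ltW.
have LEF : fnorm L * fnorm (E^T *m F) <= M * N%:R * st.
  apply: le_of_sqr; first by rewrite !mulr_ge0 // ltW.
  rewrite exprMn.
  have -> : (M * N%:R * st) ^+ 2 = (M * N%:R) * (M * (N%:R * T%:R)) by rewrite stE; ring.
  by apply: ler_pM => //; exact: sqr_ge0.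
have cross : - (fnorm L * fnorm (E^T *m F) * fnorm x ^+ 2) <=
    \tr ((F *m (L^T *m x))^T *m (E *m x)).
  rewrite trmx_mul -mulmxA /mxtrace big_ord1.
  have -> : fnorm L * fnorm (E^T *m F) * fnorm x ^+ 2 =
    (fnorm L * fnorm x) * (fnorm (E^T *m F) * fnorm x) by ring.
  apply: cV_trmul_ge; first by rewrite -(fnorm_trmx L); exact: fnormM.
  by rewrite mulmxA -(fnorm_trmx (E^T *m F)) trmx_mul trmxK; exact: fnormM.
rewrite mulmxDl -mulmxA fnorm_sqrD.
have h1 := HF (L^T *m x).
have x2 := sqr_ge0 (fnorm x).
have h2 : T%:R * g / M ^+ 2 * fnorm x ^+ 2 <= fnorm (F *m (L^T *m x)) ^+ 2.
  apply: le_trans h1.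
  have -> : T%:R * g / M ^+ 2 * fnorm x ^+ 2 = M^-1 * T%:R * (M^-1 * g * fnorm x ^+ 2).
    by field; rewrite gt_eqF.
  by rewrite ler_wpM2l // mulr_ge0 ?invr_ge0 ?ltW.
have h3 : 2 * (M * N%:R * st) <= T%:R * g / (2 * M ^+ 2).
  rewrite ler_pdivrMr ?mulr_gt0 // in Hs.
  have -> : T%:R * g / (2 * M ^+ 2) = 2 * (M * ((4 * M ^+ 3)^-1 * (st * g)) * st).
    by rewrite stE; field; rewrite gt_eqF.
  by rewrite ler_pM2l // ler_pM2r // ler_pM2l.
have h4 : T%:R * g / M ^+ 2 = 2 * (T%:R * g / (2 * M ^+ 2)).
  by field; rewrite gt_eqF.
have h5 : fnorm L * fnorm (E^T *m F) * fnorm x ^+ 2 <= (M * N%:R * st) * fnorm x ^+ 2.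
  by rewrite ler_wpM2r.
have h6 : 2 * (M * N%:R * st) * fnorm x ^+ 2 <= T%:R * g / (2 * M ^+ 2) * fnorm x ^+ 2.
  by rewrite ler_wpM2r.
have := sqr_ge0 (fnorm (E *m x)).
rewrite h4 in h2; lra.
Qed.

(** The surviving noise is of order [N sqrt T] from [E^T F L^T] and [N + T] from [E^T E]. Divided by
    the eigenvalue bound, of order [T g], it gives the stated rate, since [N <= N sqrt T]. *)
Lemma pca_bound T r N (F : 'M[R]_(T, r)) (L Q : 'M[R]_(N, r))
    (E : 'M[R]_(T, N)) (M g : R) :
  1 <= M -> 0 < g -> (0 < T)%N -> (0 < N)%N ->
  (forall y : 'cV[R]_r, M^-1 * T%:R * fnorm y ^+ 2 <= fnorm (F *m y) ^+ 2) ->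
  fnorm (E^T *m F) ^+ 2 <= M * (N%:R * T%:R) ->
  specnorm E ^+ 2 <= M * Num.max N%:R T%:R ->
  fnorm L ^+ 2 <= M * N%:R ->
  L^T *m L \in unitmx ->
  (forall y : 'cV[R]_r,
     M^-1 * g * fnorm (L *m y) ^+ 2 <= fnorm (L^T *m (L *m y)) ^+ 2) ->
  N%:R / (Num.sqrt T%:R * g) <= (4 * M ^+ 3)^-1 ->
  leading_eigvecs ((N%:R * T%:R)^-1 *:
    ((F *m L^T + E)^T *m (F *m L^T + E))) Q ->
  fnorm (Q *m Q^T - projP L) <=
    4 * M ^+ 3 * (r%:R + 1) * (N%:R / (Num.sqrt T%:R * g) + g^-1).
Proof.
move=> M1 g0 T0 N0 HF HEF HE HL Lu Hg Hs [QQ [lam [SQ [lamd lamv]]]].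
set X := F *m L^T + E in SQ lamv *.
have M0 : 0 < M by lra.
have T0' : 0 < T%:R :> R by rewrite ltr0n.
have T1 : 1 <= T%:R :> R by rewrite ler1n.
have N0' : 0 < N%:R :> R by rewrite ltr0n.
have st0 : 0 < Num.sqrt T%:R :> R by rewrite sqrtr_gt0.
have stE : T%:R = Num.sqrt T%:R ^+ 2 :> R by rewrite sqr_sqrtr // ltW.
set st := Num.sqrt T%:R in Hs st0 stE *.
have st1 : 1 <= st by rewrite leNgt; apply/negP => h; nra.
have Pp := orthproj_projP Lu.
(* The bound of [pca_quad_lower] in the normalisation of the sample covariance; the factor
   [1 / (N T)] cancels again in [Db]. *)
set c := (N%:R * T%:R)^-1 * (T%:R * g / (2 * M ^+ 2)).
have c0 : 0 < c by rewrite !(mulr_gt0, invr_gt0, exprn_gt0).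
have lamc : forall j, c <= lam 0 j.
  apply: (leading_eigvals_ge _ QQ SQ lamd lamv (gram_unitmx_inj Lu)).
    by rewrite linearZ /= trmx_mul trmxK.
  move=> y; rewrite -scalemxAr -scalemxAl scalemxE /c -[leLHS]mulrA.
  rewrite ler_pM2l ?invr_gt0 ?mulr_gt0 //.
  have -> : (L *m y)^T *m (X^T *m X) *m (L *m y) = (X *m (L *m y))^T *m (X *m (L *m y)).
    by rewrite (trmx_mul X) !mulmxA.
  rewrite -fnorm_sqr_cV.
  exact: pca_quad_lower.
set D := fnorm ((1%:M - projP L) *m Q).
have D0 : 0 <= D := fnorm_ge0 _.
have PL : (1%:M - projP L) *m L = 0 by rewrite mulmxBl mul1mx projP_mul // subrr.
have eqD : (1%:M - projP L) *m Q *m diag_mx lam = (N%:R * T%:R)^-1 *: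
    ((1%:M - projP L) *m ((E^T *m F) *m (L^T *m Q) + E^T *m (E *m Q))).
  have XQ : X^T *m X *m Q = L *m (F^T *m (X *m Q)) + ((E^T *m F) *m (L^T *m Q) + E^T *m
    (E *m Q)).
    rewrite -mulmxA {1}/X [(_ + E)^T]linearD /= trmx_mul trmxK mulmxDl -mulmxA.
    congr (_ + _); first by rewrite -mulmxA.
    by rewrite /X mulmxDl mulmxDr -!mulmxA.
  rewrite -mulmxA -SQ -scalemxAl -scalemxAr XQ; congr (_ *: _).
  by rewrite [in LHS]mulmxDr (mulmxA _ L) PL mul0mx add0r.
set sr := r%:R + 1 : R.
set q := fnorm Q.
have q0 : 0 <= q := fnorm_ge0 _.
have LEF : fnorm L * fnorm (E^T *m F) <= M * N%:R * st.
  apply: le_of_sqr; first by rewrite !mulr_ge0 // ltW.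
  rewrite exprMn.
  have -> : (M * N%:R * st) ^+ 2 = (M * N%:R) * (M * (N%:R * T%:R)) by rewrite stE; ring.
  by apply: ler_pM => //; exact: sqr_ge0.
have up : fnorm ((E^T *m F) *m (L^T *m Q) + E^T *m (E *m Q)) <=
    M * (N%:R * st + N%:R + T%:R) * q.
  apply: le_trans (fnormD _ _) _.
  have u1 : fnorm (E^T *m F *m (L^T *m Q)) <= M * N%:R * st * q.
    apply: le_trans (fnormM _ _) _; apply: (@le_trans _ _ (fnorm (E^T *m F) * (fnorm L
      * q))).
      by rewrite ler_wpM2l ?fnorm_ge0 // -(fnorm_trmx L); exact: fnormM.
    by rewrite mulrA (mulrC (fnorm (E^T *m F))) ler_wpM2r.
  have u2 : fnorm (E^T *m (E *m Q)) <= M * (N%:R + T%:R) * q.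
    apply: le_trans (fnormM_spec_tr _ _) _.
    apply: (@le_trans _ _ (specnorm E * (specnorm E * q))).
      by rewrite ler_wpM2l ?specnorm_ge0 //; exact: fnormM_spec.
    rewrite mulrA -expr2 ler_wpM2r //; apply: le_trans HE _.
    by rewrite ler_pM2l // ge_max lerDl lerDr !ltW.
  by apply: le_trans (lerD u1 u2) _; rewrite -mulrDl ler_wpM2r //; lra.
have cD : c * D <= (N%:R * T%:R)^-1 * (M * (N%:R * st + N%:R + T%:R) * q).
  apply: (@le_trans _ _ (fnorm ((1%:M - projP L) *m Q *m diag_mx lam))).
    apply: fnorm_diag_mulr_ge; first exact: ltW.
    by move=> j; rewrite (le_trans (lamc j)) // ler_norm.
  rewrite eqD fnormZ ger0_norm ?invr_ge0 ?mulr_ge0 ?(ltW T0') ?(ltW N0') //.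
  rewrite ler_pM2l ?invr_gt0 ?mulr_gt0 //; apply: le_trans up.
  exact: fnorm_orthproj_le (orthproj_compl Pp).
set b := 2 * M ^+ 3 * (2 * (N%:R / (st * g)) + g^-1).
have b0 : 0 <= b.
  by rewrite !(mulr_ge0, addr_ge0, invr_ge0, exprn_ge0) // ltW.
have Db : D <= b * q.
  rewrite /c -mulrA ler_pM2l ?invr_gt0 ?mulr_gt0 // in cD.
  have k0 : 0 < T%:R * g / (2 * M ^+ 2) by rewrite !(mulr_gt0, invr_gt0, exprn_gt0).
  rewrite -(ler_pM2l k0); apply: le_trans cD _.
  have -> : T%:R * g / (2 * M ^+ 2) * (b * q) = M * (2 * N%:R * st + T%:R) * q.
    by rewrite /b stE; field; rewrite !gt_eqF.
  rewrite ler_wpM2r // ler_pM2l //.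
  have : N%:R <= N%:R * st by rewrite ler_peMr // ltW.
  lra.
have bb : b * sr <= 4 * M ^+ 3 * sr * (N%:R / (st * g) + g^-1).
  have -> : 4 * M ^+ 3 * sr * (N%:R / (st * g) + g^-1) =
     (b + 2 * M ^+ 3 * g^-1) * sr by rewrite /b; ring.
  rewrite ler_wpM2r ?addr_ge0 // lerDl.
  by rewrite !(mulr_ge0, addr_ge0, invr_ge0, exprn_ge0) // ltW.
apply: le_trans bb; apply: le_of_sqr; first by rewrite mulr_ge0 // addr_ge0.
rewrite (orthproj_dist Pp (mxtrace_projP Lu) QQ) -/D.
apply: (@le_trans _ _ (2 * (b * q) ^+ 2)); first by rewrite ler_pM2l // sqr_le.
have -> : 2 * (b * q) ^+ 2 = b ^+ 2 * (2 * q ^+ 2) by ring.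
have -> : (b * sr) ^+ 2 = b ^+ 2 * sr ^+ 2 by ring.
rewrite (fnorm_orthonormal QQ) ler_wpM2l ?sqr_ge0 //.
(* The squared norm of [Q] is [r], and [2 r <= (r + 1)^2]. *)
rewrite /sr; have := sqr_ge0 (r%:R : R); nra.
Qed.

(** The eigenvalues attached to [Q] are at least [1 - 2 e], whereas [S] shrinks [Y = (1 - P) Q] by
    [1 - k]; the eigenvalue equation projected by [1 - P] then gives
    [(k - 2 e) fnorm Y <= 2 e (s + 1)]. *)
Lemma subspace_perturbation N s (Phat S : 'M[R]_N) (A Q : 'M[R]_(N, s)) (k e : R) :
  A^T *m A \in unitmx -> Phat^T = Phat -> leading_eigvecs Phat Q -> 0 < k ->
  fnorm (Phat - projP A - S) <= e -> fnorm (S *m projP A) <= e ->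
  specnorm S <= 1 - k ->
  fnorm ((1%:M - projP A) *m Q) <= 4 / k * (s%:R + 1) * e.
Proof.
move=> Au Pt [QQ [lam [SQ [lamd lamv]]]] k0 he hS Sk.
have Pp := orthproj_projP Au; set P := projP A in he hS Pp *.
set D := Phat - P - S in he.
have PE : Phat = P + S + D by apply/matrixP => i j; rewrite !mxE; ring.
clearbody D.
have e0 : 0 <= e by apply: le_trans he; exact: fnorm_ge0.
have q1 := orthonormal_fnorm_le QQ; have s0 := ler0n R s.
have qD : fnorm ((1%:M - P) *m Q) <= s%:R + 1.
  by apply: le_trans q1; exact: fnorm_orthproj_le (orthproj_compl Pp).
(* If [4 e > k] the claim is weaker than the trivial bound [s + 1]; otherwise [2 e <= k / 2] leaves
   half of the gap. *)
have [ek|ek] := ltP k (4 * e).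
  apply: le_trans qD _; rewrite mulrAC ler_peMl ?addr_ge0 //.
  by rewrite mulrAC ler_pdivlMr // mul1r ltW.
have lamc : forall j, 1 - 2 * e <= lam 0 j.
  apply: (leading_eigvals_ge Pt QQ SQ lamd lamv (gram_unitmx_inj Au)).
  move=> y; set x := A *m y.
  have Px : P *m x = x by rewrite /x mulmxA projP_mul.
  rewrite PE !mulmxDr !mulmxDl !addmxE -(mulmxA _ P) Px -fnorm_sqr_cV.
  have h1 : - (fnorm x * (e * fnorm x)) <= (x^T *m S *m x) 0 0.
    rewrite -mulmxA; apply: cV_trmul_ge => //.
    rewrite -{1}Px mulmxA; apply: le_trans (fnormM _ _) _.
    by rewrite ler_wpM2r ?fnorm_ge0.
  have h2 : - (fnorm x * (e * fnorm x)) <= (x^T *m D *m x) 0 0.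
    rewrite -mulmxA; apply: cV_trmul_ge => //.
    apply: le_trans (fnormM _ _) _.
    by rewrite ler_wpM2r ?fnorm_ge0.
  have -> : (1 - 2 * e) * fnorm x ^+ 2 = fnorm x ^+ 2 - 2 * (fnorm x * (e * fnorm x))
    by ring.
  lra.
set Y := (1%:M - P) *m Q in qD *.
have YE : Y *m diag_mx lam = (1%:M - P) *m (S *m Y) + (1%:M - P) *m (S *m P *m Q + D *m
  Q).
  have PQ : Phat *m Q = P *m Q + (S *m Q + D *m Q) by rewrite PE !mulmxDl addrA.
  have CP : (1%:M - P) *m (P *m Q) = 0.
    by rewrite mulmxA mulmxBl mul1mx Pp.2 subrr mul0mx.
  rewrite -[in LHS]mulmxA -SQ PQ mulmxDr CP add0r -mulmxDr addrA; congr (_ *m (_ + _)).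
  by rewrite /Y -mulmxA -mulmxDr -mulmxDl subrK mul1mx.
have Y0 : 0 <= fnorm Y := fnorm_ge0 _.
have cp := orthproj_compl Pp.
have lo : (1 - 2 * e) * fnorm Y <= fnorm (Y *m diag_mx lam).
  have [h|h] := leP 0 (1 - 2 * e).
    apply: fnorm_diag_mulr_ge => // j.
    by rewrite (le_trans (lamc j)) // ler_norm.
  by apply: le_trans (fnorm_ge0 _); rewrite nmulr_rle0.
have hi : fnorm (Y *m diag_mx lam) <= (1 - k) * fnorm Y + 2 * e * (s%:R + 1).
  rewrite YE; apply: le_trans (fnormD _ _) _; apply: lerD.
    apply: le_trans (fnorm_orthproj_le _ cp) _; apply: le_trans (fnormM_spec _ _) _.
    by rewrite ler_wpM2r.
  apply: le_trans (fnorm_orthproj_le _ cp) _; apply: le_trans (fnormD _ _) _.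
  have -> : 2 * e * (s%:R + 1) = e * (s%:R + 1) + e * (s%:R + 1) by ring.
  by apply: lerD; apply: le_trans (fnormM _ _) _; apply: ler_pM; rewrite ?fnorm_ge0.
have : (k / 2) * fnorm Y <= 2 * e * (s%:R + 1) by nra.
rewrite -ler_pdivlMl; last by rewrite divr_gt0.
move=> h; apply: le_trans h _; rewrite le_eqVlt; apply/orP; left; apply/eqP.
by field; rewrite gt_eqF.
Qed.

End Perturbation.

(** * Loadings normalised by factor strength *)

Section NearIsometry.
Context {R : realType}.

(** What (A2) gives from some index on, once the Gram deviation is below 1/2. The vectorwise form
    passes to column blocks by padding [z] with zeros. *)
Definition near_isometry m n (B : 'M[R]_(m, n)) := forall z : 'cV[R]_n,
  2^-1 * fnorm z ^+ 2 <= fnorm (B *m z) ^+ 2 <= 2 * fnorm z ^+ 2.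

Lemma near_isometry_spec m n (B : 'M[R]_(m, n)) :
  specnorm (B^T *m B - 1%:M) <= 2^-1 -> near_isometry B.
Proof.
move=> HB z; set C := _ - 1%:M in HB.
have BE : B^T *m B = 1%:M + C by rewrite addrC subrK.
have h (w : 'cV[R]_n) : fnorm w = fnorm z -> - (fnorm z * (2^-1 * fnorm z)) <= (w^T *m
  (C *m z)) 0 0.
  move=> wz; apply: cV_trmul_ge; first by rewrite wz.
  by apply: le_trans (fnormM_spec _ _) _; rewrite ler_wpM2r ?fnorm_ge0.
have := h z erefl; have := h (- z) (fnormN _).
rewrite linearN /= mulNmx oppmxE (fnorm_sqr_cV (B *m z)).
have -> : (B *m z)^T *m (B *m z) = z^T *m z + z^T *m (C *m z).
  by rewrite trmx_mul -mulmxA (mulmxA B^T) BE mulmxDl mul1mx mulmxDr.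
rewrite addmxE -fnorm_sqr_cV => h1 h2; have := sqr_ge0 (fnorm z).
by move=> h3; apply/andP; split; lra.
Qed.

Lemma near_isometry_row_mxr m n p (A : 'M[R]_(m, n)) (B : 'M[R]_(m, p)) :
  near_isometry (row_mx A B) -> near_isometry B.
Proof.
move=> h z; have := h (col_mx 0 z); rewrite mul_row_col mulmx0 add0r.
by rewrite -[fnorm (col_mx _ _)]fnorm_trmx tr_col_mx fnorm_row_mx trmx0 fnorm0 expr0n
  add0r fnorm_trmx.
Qed.

Lemma near_isometry_row_mxl m n p (A : 'M[R]_(m, n)) (B : 'M[R]_(m, p)) :
  near_isometry (row_mx A B) -> near_isometry A.
Proof.
move=> h z; have := h (col_mx z 0); rewrite mul_row_col mulmx0 addr0.
by rewrite -[fnorm (col_mx _ _)]fnorm_trmx tr_col_mx fnorm_row_mx trmx0 fnorm0 expr0n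
  addr0 fnorm_trmx.
Qed.

Lemma near_isometry_fnorm m n (B : 'M[R]_(m, n)) : near_isometry B ->
  fnorm B ^+ 2 <= 2 * n%:R.
Proof.
move=> h; rewrite fnorm_cols.
apply: (@le_trans _ _ (\sum_(j < n) (2 : R))); last first.
  by rewrite sumr_const card_ord mulr_natr.
apply: ler_sum => j _; rewrite colE; have /andP[_ h2] := h (delta_mx j 0).
apply: le_trans h2 _; rewrite fnorm_sqr_cV.
by rewrite trmx_delta mul_delta_mx !mxE !eqxx mulr1.
Qed.

Lemma near_isometry_gram_ge m n (B : 'M[R]_(m, n)) (z : 'cV[R]_n) :
  near_isometry B -> 2^-1 * fnorm z <= fnorm (B^T *m (B *m z)).
Proof.
move=> /(_ z) /andP[h _].
have [->|z0] := eqVneq z 0; first by rewrite !mulmx0 !fnorm0 mulr0.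
rewrite -(ler_pM2r (fnorm_gt0 z0)) -mulrA -expr2; apply: le_trans h _.
by rewrite fnorm_sqr trmx_mul -mulmxA mulrC; exact: mxtrace_trmul_le.
Qed.

Lemma diag_sqrtK n (d : 'rV[R]_n) : (forall j, 0 < d 0 j) ->
  diag_mx (\row_i (Num.sqrt (d 0 i))^-1) *m diag_mx (map_mx Num.sqrt d) = 1%:M.
Proof.
move=> d0; apply/matrixP => i j; rewrite mul_diag_mx !mxE.
by have [->|] := eqVneq i j; rewrite ?mulr0n ?mulr0 // !mulr1n mulVf // gt_eqF //
  sqrtr_gt0.
Qed.

Section Scaled.
Variables (m n : nat) (L : 'M[R]_(m, n)) (d : 'rV[R]_n).
Let B := L *m diag_mx (\row_i (Num.sqrt (d 0 i))^-1).
Hypothesis d0 : forall j, 0 < d 0 j.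
Hypothesis hB : near_isometry B.

(** All disparity between factor strengths sits in the diagonal factor, so facts about [L] reduce to
    the well-conditioned [B]. *)
Lemma scaled_factor : L = B *m diag_mx (map_mx Num.sqrt d).
Proof. by rewrite /B -mulmxA diag_sqrtK // mulmx1. Qed.

Lemma scaled_gram_unitmx : L^T *m L \in unitmx.
Proof.
apply: gram_unitmx => y; rewrite scaled_factor -mulmxA => By.
have /andP[h _] := hB (diag_mx (map_mx Num.sqrt d) *m y).
rewrite By fnorm0 expr0n /= in h.
have z0 : diag_mx (map_mx Num.sqrt d) *m y = 0.
  apply: fnorm_eq0; apply/eqP; rewrite -sqrf_eq0 eq_le sqr_ge0 andbT.
  by move: h; rewrite pmulr_rle0 // invr_gt0.
by rewrite -[y]mul1mx -(diag_sqrtK d0) -mulmxA z0 mulmx0.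
Qed.

Lemma scaled_fnorm b : 0 <= b -> (forall j, d 0 j <= b) ->
  fnorm L ^+ 2 <= 2 * n%:R * b.
Proof.
move=> b0 db; rewrite scaled_factor.
have h : fnorm (B *m diag_mx (map_mx Num.sqrt d)) <= Num.sqrt b * fnorm B.
  apply: fnorm_diag_mulr_le => [|j]; first exact: sqrtr_ge0.
  by rewrite mxE ger0_norm ?sqrtr_ge0 // ler_sqrt.
apply: le_trans (sqr_le (fnorm_ge0 _) h) _.
by rewrite exprMn sqr_sqrtr // mulrC ler_wpM2r // near_isometry_fnorm.
Qed.

(** With [L y = B z], the vector [L^T B z] has norm at least [sqrt a / 2] times that of [z];
    squaring gives [a / 4], and [fnorm (B z) ^+ 2 <= 2 * fnorm z ^+ 2] turns it into [a / 8]. *)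
Lemma scaled_gram_ge a (y : 'cV[R]_n) : 0 <= a -> (forall j, a <= d 0 j) ->
  8^-1 * a * fnorm (L *m y) ^+ 2 <= fnorm (L^T *m (L *m y)) ^+ 2.
Proof.
move=> a0 ad; rewrite [L in L *m y]scaled_factor -mulmxA.
set z := diag_mx _ *m y; have /andP[_ h2] := hB z.
have h1 := near_isometry_gram_ge z hB.
have h3 : Num.sqrt a * fnorm (B^T *m (B *m z)) <= fnorm (L^T *m (B *m z)).
  rewrite [in leRHS]scaled_factor [(B *m _)^T]trmx_mul tr_diag_mx -(mulmxA _ B^T).
  apply: fnorm_diag_mull_ge => [|j]; first exact: sqrtr_ge0.
  by rewrite mxE ger0_norm ?sqrtr_ge0 // ler_sqrt // ltW.
apply: (@le_trans _ _ ((Num.sqrt a * (2^-1 * fnorm z)) ^+ 2)).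
  rewrite !exprMn (sqr_sqrtr a0); have := ler_wpM2l a0 h2; lra.
apply: sqr_le; first by rewrite !mulr_ge0 ?sqrtr_ge0 ?fnorm_ge0.
by apply: le_trans h3; rewrite ler_wpM2l ?sqrtr_ge0.
Qed.

(** Serves to write [E P Q] as [(E B) Z]: (A4) controls [E B] by [sqrt T] with no growth in [N],
    which the spectral norm of [E] would not give. *)
Lemma scaled_projP_factor p (x : 'M[R]_(m, p)) :
  exists2 Z : 'M[R]_(n, p), projP L *m x = B *m Z & fnorm Z ^+ 2 <= 2 * fnorm x ^+ 2.
Proof.
pose Z := diag_mx (map_mx Num.sqrt d) *m invmx (L^T *m L) *m L^T *m x.
have ZE : projP L *m x = B *m Z by rewrite /projP {1}scaled_factor /Z !mulmxA.
exists Z => //.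
have lo : fnorm Z ^+ 2 <= 2 * fnorm (B *m Z) ^+ 2.
  rewrite !fnorm_cols mulr_sumr; apply: ler_sum => j _.
  rewrite [col j (B *m Z)]colE -mulmxA -colE.
  by have /andP[h _] := hB (col j Z); lra.
apply: le_trans lo _; rewrite -ZE ler_pM2l // sqr_le ?fnorm_ge0 //.
by apply: fnorm_orthproj_le; apply: orthproj_projP; exact: scaled_gram_unitmx.
Qed.

End Scaled.
End NearIsometry.

(** * The rotation matrix *)

Section Rotation.
Context {R : realType}.

Lemma le_mul_sqrt (x y M : R) : 1 <= M -> 0 <= y -> x ^+ 2 <= M * y ->
  x <= M * Num.sqrt y.
Proof.
move=> M1 y0 h; apply: le_of_sqr; first by rewrite mulr_ge0 ?sqrtr_ge0 //; lra.
by rewrite exprMn sqr_sqrtr //; apply: le_trans h _; rewrite ler_wpM2r //; nra.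
Qed.

(** The least-squares coefficients of the estimated loadings on the columns of [A]. *)
Definition rotation N s (A Q : 'M[R]_(N, s)) (d : 'rV[R]_s) : 'M[R]_s :=
  invmx (A^T *m A) *m A^T *m Q *m diag_mx (map_mx Num.sqrt d).

(** The test on [unitmx] secures invertibility for every input, even where [A^T A] is singular; the
    test on the norm selects the regime where the perturbation argument applies. *)
Definition trans_rotation N s (A Q : 'M[R]_(N, s)) (d : 'rV[R]_s) : 'M[R]_s :=
  if (fnorm ((1%:M - projP A) *m Q) <= 2^-1) && (rotation A Q d \in unitmx)
  then rotation A Q d else 1%:M.

Lemma trans_rotation_unitmx N s (A Q : 'M[R]_(N, s)) (d : 'rV[R]_s) :
  trans_rotation A Q d \in unitmx.
Proof.
by rewrite /trans_rotation; case: ifP => [/andP[]//|_]; exact: unitmx1.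
Qed.

(** [V = P Q K^-1] with [K = Q^T P Q = 1 - Y^T Y] is the frame dual to [Q] inside the range of [P].
    If [P Q y = 0] then [Q y = Y y], so [fnorm y <= fnorm y / 2] and [K] is invertible. *)
Lemma dual_frame N s (A Q : 'M[R]_(N, s)) :
  A^T *m A \in unitmx -> Q^T *m Q = 1%:M ->
  fnorm ((1%:M - projP A) *m Q) <= 2^-1 ->
  exists V : 'M[R]_(N, s), [/\ Q^T *m V = 1%:M, projP A *m V = V &
    fnorm (V - Q) <= 2 * fnorm ((1%:M - projP A) *m Q)].
Proof.
move=> Au QQ; move: (projP A) (orthproj_projP Au) => P Pp.
have Cp := orthproj_compl Pp.
set Y := (1%:M - P) *m Q; set D := fnorm Y => D2.
have D0 : 0 <= D := fnorm_ge0 _.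
pose K := (P *m Q)^T *m (P *m Q).
have PQE : P *m Q = Q - Y by rewrite /Y mulmxBl mul1mx opprB addrC subrK.
have Ku : K \in unitmx.
  apply: gram_unitmx => y Py; apply: fnorm_eq0; apply/eqP.
  have : fnorm y <= 2^-1 * fnorm y.
    rewrite -{1}(orthonormal_fnormM y QQ) (_ : Q *m y = Y *m y).
      by apply: le_trans (fnormM _ _) _; rewrite ler_wpM2r ?fnorm_ge0.
    by move: Py; rewrite PQE mulmxBl => /eqP; rewrite subr_eq0 => /eqP.
  by have := fnorm_ge0 y; rewrite eq_le => y0 h; apply/andP; split => //; lra.
have KE : K = Q^T *m (P *m Q).
  by rewrite /K trmx_mul Pp.1 -mulmxA (mulmxA P) Pp.2.
have KE' : K = 1%:M - Y^T *m Y.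
  rewrite KE PQE mulmxBr QQ; congr (_ - _).
  by rewrite /Y trmx_mul Cp.1 -mulmxA (mulmxA (1%:M - P) _ Q) Cp.2.
exists (P *m Q *m invmx K); split.
- by rewrite mulmxA -KE mulmxV.
- by rewrite !mulmxA Pp.2.
set W := _ - Q.
(* A contracting equation for [W]: it yields [(1 - D^2) fnorm W <= D^2 + D], and [D <= 1/2] turns
   this into [2 D]. *)
have WE : W = W *m (Y^T *m Y) + (Q *m (Y^T *m Y) - Y).
  have : W *m K = P *m Q - Q *m K by rewrite /W mulmxBl mulmxKV.
  rewrite KE' !mulmxBr !mulmx1 PQE => h.
  by rewrite -[LHS](subrK (W *m (Y^T *m Y))) h addrC; congr (_ + _); apply/matrixP => i
    j; rewrite !mxE; ring.
have YY : fnorm (Y^T *m Y) <= D ^+ 2.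
  by apply: le_trans (fnormM _ _) _; rewrite fnorm_trmx expr2.
have w1 : fnorm W <= fnorm W * D ^+ 2 + (D ^+ 2 + D).
  rewrite {1}WE; apply: le_trans (fnormD _ _) _; apply: lerD.
    by apply: le_trans (fnormM _ _) _; rewrite ler_wpM2l ?fnorm_ge0.
  apply: le_trans (fnormB _ _) _; apply: lerD => //.
  by rewrite orthonormal_fnormM.
have w0 := fnorm_ge0 W; have D4 : D ^+ 2 <= 4^-1 by nra.
nra.
Qed.

(** In the product of the two matrices the inverse Gram matrix is absorbed into [projP A], which
    fixes [V], and [Q^T V = 1] is left between inverse diagonals. For square matrices a one-sided
    inverse is enough. *)
Lemma rotation_inv N s (A Q V : 'M[R]_(N, s)) (d : 'rV[R]_s) :
  A^T *m A \in unitmx -> Q^T *m V = 1%:M -> projP A *m V = V ->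
  (forall j, 0 < d 0 j) ->
  rotation A Q d \in unitmx /\ (invmx (rotation A Q d))^T =
    A^T *m V *m diag_mx (\row_i (Num.sqrt (d 0 i))^-1).
Proof.
move=> Au QV PV d0; set W := A^T *m V *m _; set H := rotation A Q d.
have WH : W^T *m H = 1%:M.
  have <- : (H^T *m W)^T = W^T *m H by rewrite trmx_mul trmxK.
  rewrite -trmx1; congr (_^T); rewrite /H /rotation /W.
  rewrite !trmx_mul tr_diag_mx !trmxK trmx_inv trmx_mul trmxK.
  have -> : diag_mx (map_mx Num.sqrt d) *m (Q^T *m (A *m invmx (A^T *m A))) *m
    (A^T *m V *m diag_mx (\row_i (Num.sqrt (d 0 i))^-1)) =
    diag_mx (map_mx Num.sqrt d) *m (Q^T *m (projP A *m V)) *m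
      diag_mx (\row_i (Num.sqrt (d 0 i))^-1) by rewrite /projP !mulmxA.
  rewrite PV QV mulmx1; apply/matrixP => i j; rewrite mul_diag_mx !mxE.
  have [->|] := eqVneq i j; rewrite ?mulr0n ?mulr0 // !mulr1n mulfV //.
  by rewrite gt_eqF // sqrtr_gt0.
have [_ Hu] := mulmx1_unit WH; split => //.
by rewrite -[invmx H]mul1mx -WH mulmxK // trmxK.
Qed.

Lemma trans_rotation_good N s (A Q : 'M[R]_(N, s)) (d : 'rV[R]_s) :
  A^T *m A \in unitmx -> Q^T *m Q = 1%:M -> (forall j, 0 < d 0 j) ->
  fnorm ((1%:M - projP A) *m Q) <= 2^-1 ->
  Q *m diag_mx (map_mx Num.sqrt d) - A *m trans_rotation A Q d =
    (1%:M - projP A) *m Q *m diag_mx (map_mx Num.sqrt d) /\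
  exists V : 'M[R]_(N, s),
    [/\ fnorm (V - Q) <= 2 * fnorm ((1%:M - projP A) *m Q) &
     (invmx (trans_rotation A Q d))^T =
       A^T *m V *m diag_mx (\row_i (Num.sqrt (d 0 i))^-1)].
Proof.
move=> Au QQ d0 D2; have [V [QV PV VQ]] := dual_frame Au QQ D2.
have [Hu HV] := rotation_inv Au QV PV d0.
rewrite /trans_rotation D2 Hu /=; split; last by exists V.
by rewrite /rotation !mulmxA !mulmxBl !mul1mx.
Qed.

End Rotation.

(** * From the subspace error to loadings and factors *)

Section Transfer.
Context {R : realType}.
Variables (T N s q : nat) (Ls : 'M[R]_(N, q)) (Lw Q : 'M[R]_(N, s)).
Variables (Fs : 'M[R]_(T, q)) (Fw : 'M[R]_(T, s)) (E : 'M[R]_(T, N)).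
Variables (d : 'rV[R]_s) (M a1 a2 rho : R).
Let H := trans_rotation Lw Q d.
Let P := projP Lw.
Let B := Lw *m diag_mx (\row_i (Num.sqrt (d 0 i))^-1).
Hypotheses (M1 : 1 <= M) (d0 : forall j, 0 < d 0 j).
Hypotheses (a10 : 0 < a1) (a20 : 0 < a2) (T0 : (0 < T)%N) (N0 : (0 < N)%N).
Hypotheses (QQ : Q^T *m Q = 1%:M) (hB : near_isometry B).
Hypotheses (hd1 : forall j, d 0 j <= M * a1) (hd2 : forall j, a2 <= M * d 0 j).
Hypotheses (hLw1 : fnorm Lw ^+ 2 <= M * a1).
Hypothesis (hrho : fnorm ((1%:M - P) *m Q) <= M * rho).

Let M0 : 0 < M. Proof. by apply: lt_le_trans M1. Qed.
Let rho0 : 0 <= rho.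
Proof.
by have := le_trans (fnorm_ge0 _) hrho; rewrite pmulr_rge0.
Qed.
Let Lwu : Lw^T *m Lw \in unitmx. Proof. exact: scaled_gram_unitmx hB. Qed.
Let dhi j : `|(map_mx Num.sqrt d) 0 j| <= M * Num.sqrt a1.
Proof.
rewrite mxE ger0_norm ?sqrtr_ge0 //; apply: le_mul_sqrt => //; first exact: ltW.
by rewrite sqr_sqrtr // ltW.
Qed.
Let dlo j : `|(\row_i (Num.sqrt (d 0 i))^-1) 0 j| <= M / Num.sqrt a2.
Proof.
rewrite mxE ger0_norm ?invr_ge0 ?sqrtr_ge0 //.
rewrite ler_pdivlMr ?sqrtr_gt0 // mulrC ler_pdivrMr ?sqrtr_gt0 //.
apply: le_mul_sqrt => //; first exact: ltW.
by rewrite sqr_sqrtr ?hd2 // ltW.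
Qed.
Let qs : fnorm Q <= s%:R + 1. Proof. exact: orthonormal_fnorm_le. Qed.
Let s0 : 0 <= s%:R :> R. Proof. by []. Qed.

(** Here [a1] stands for the largest weak strength, [a2] for the smallest one and [rho] for the
    rate. Both branches of [trans_rotation] are bounded separately. *)
Lemma transfer_loading :
  fnorm (Q *m diag_mx (map_mx Num.sqrt d) - Lw *m H) <=
    8 * M ^+ 4 * (s%:R + 2) * (Num.sqrt a1 * rho).
Proof.
have sa0 := sqrtr_ge0 a1.
have M2 : 1 <= M ^+ 2 by exact: exprn_ege1.
have M24 : M ^+ 2 <= M ^+ 4 by rewrite (_ : M ^+ 4 = M ^+ 2 * M ^+ 2); [nra|ring].
have ar0 : 0 <= Num.sqrt a1 * rho by rewrite mulr_ge0.
have [D2|D2] := leP (fnorm ((1%:M - P) *m Q)) 2^-1.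
  have [-> _] := trans_rotation_good Lwu QQ d0 D2.
  apply: (@le_trans _ _ (M * Num.sqrt a1 * (M * rho))).
    apply: le_trans (fnorm_diag_mulr_le _ _ dhi) _; first by rewrite mulr_ge0 // ltW.
    by rewrite ler_wpM2l // mulr_ge0 // ltW.
  have -> : M * Num.sqrt a1 * (M * rho) = M ^+ 2 * (Num.sqrt a1 * rho) by ring.
  rewrite ler_wpM2r //; have : 0 <= M ^+ 4 * s%:R by rewrite mulr_ge0 ?exprn_ge0 // ltW.
  lra.
have -> : H = 1%:M by rewrite /H /trans_rotation leNgt D2.
rewrite mulmx1; apply: le_trans (fnormB _ _) _.
have h1 : fnorm (Q *m diag_mx (map_mx Num.sqrt d)) <= M * Num.sqrt a1 * (s%:R + 1).
  apply: le_trans (fnorm_diag_mulr_le _ _ dhi) _; first by rewrite mulr_ge0 // ltW.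
  by rewrite ler_wpM2l // mulr_ge0 // ltW.
have h2 : fnorm Lw <= M * Num.sqrt a1 by apply: le_mul_sqrt => //; exact: ltW.
(* In the default branch the crude bound may be multiplied by [2 M rho >= 1], which brings in the
   rate. *)
have hr : 1 <= 2 * (M * rho) by have := le_trans (ltW D2) hrho; lra.
apply: (@le_trans _ _ (M * Num.sqrt a1 * (s%:R + 2))); first by lra.
apply: (@le_trans _ _ (M * Num.sqrt a1 * (s%:R + 2) * (2 * (M * rho)))).
  by rewrite ler_peMr // !mulr_ge0 ?addr_ge0 // ltW.
have -> : M * Num.sqrt a1 * (s%:R + 2) * (2 * (M * rho)) =
  2 * M ^+ 2 * (s%:R + 2) * (Num.sqrt a1 * rho) by ring.
rewrite ler_wpM2r // ler_wpM2r ?addr_ge0 //; lra.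
Qed.

Hypotheses (a2N : a2 <= N%:R) (orth : Ls^T *m P = 0).
Hypotheses (hLw : fnorm Lw ^+ 2 <= M * N%:R) (hLs : fnorm Ls ^+ 2 <= M * N%:R).
Hypotheses (hFs : fnorm Fs ^+ 2 <= M * T%:R) (hFw : fnorm Fw ^+ 2 <= M * T%:R).
Hypotheses (hE : specnorm E ^+ 2 <= M * Num.max N%:R T%:R).
Hypotheses (hEB : fnorm (E *m B) ^+ 2 <= M * T%:R).

Let X := row_mx Fs Fw *m (row_mx Ls Lw)^T + E.
Let Di := diag_mx (\row_i (Num.sqrt (d 0 i))^-1).

Lemma factor_estimate :
  X *m (Q *m diag_mx (map_mx Num.sqrt d)) *m invmx (diag_mx d) = X *m Q *m Di.
Proof.
have du : diag_mx d \in unitmx.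
  rewrite unitmxE unitfE det_diag prodf_seq_neq0; apply/allP => i _.
  by rewrite gt_eqF.
rewrite -!mulmxA; congr (_ *m (_ *m _)).
apply: (can_inj (mulmxK du)); rewrite mulmxKV //.
apply/matrixP => i j; rewrite /Di mul_diag_mx !mxE.
have [->|] := eqVneq i j; rewrite ?mulr0n ?mulr0 // !mulr1n.
have h := sqr_sqrtr (ltW (d0 j)); rewrite -{3}h expr2 mulKf //.
by rewrite gt_eqF // sqrtr_gt0.
Qed.

(** In the regular branch the error has four parts: strong factors, weak factors, and noise along
    and off the range of [P]. All carry [rho] except the noise along [P], which produces the
    separate term [1 / sqrt a2]. *)
Lemma transfer_factor :
  fnorm (X *m (Q *m diag_mx (map_mx Num.sqrt d)) *m invmx (diag_mx d)
         - Fw *m (invmx H)^T) <=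
    8 * M ^+ 4 * (s%:R + 2) * Num.sqrt T%:R *
      (Num.sqrt N%:R / Num.sqrt a2 * rho + (Num.sqrt a2)^-1).
Proof.
rewrite factor_estimate.
set t := Num.sqrt T%:R; set n := Num.sqrt N%:R; set ai := (Num.sqrt a2)^-1.
have t0 : 0 <= t := sqrtr_ge0 _.
have n0 : 0 <= n := sqrtr_ge0 _.
have ai0 : 0 <= ai by rewrite invr_ge0 sqrtr_ge0.
have Mge0 := ltW M0.
have M3 : 1 <= M ^+ 3 by apply: exprn_ege1.
have M34 : M ^+ 3 <= M ^+ 4 by rewrite (exprS M 3) ler_peMl // exprn_ge0.
have M24 : M ^+ 2 <= M ^+ 4 by rewrite (exprD M 2 2) ler_peMl ?exprn_ge0 ?exprn_ege1.
have nai : 1 <= n * ai.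
  by rewrite ler_pdivlMr ?sqrtr_gt0 // mul1r /n ler_sqrt.
have lLw : fnorm Lw <= M * n by apply: le_mul_sqrt.
have lLs : fnorm Ls <= M * n by apply: le_mul_sqrt.
have lFs : fnorm Fs <= M * t by apply: le_mul_sqrt.
have lFw : fnorm Fw <= M * t by apply: le_mul_sqrt.
have lEB : fnorm (E *m B) <= M * t by apply: le_mul_sqrt.
(* [N] and [T] are at least 1, so [max (N, T) <= N T]; this coarse bound is used only where a factor
   [rho] is present or can be supplied. *)
have lE : specnorm E <= M * (n * t).
  rewrite /n /t -sqrtrM //; apply: le_mul_sqrt => //.
  apply: le_trans hE _; rewrite ler_pM2l // ge_max.
  by rewrite ler_peMr ?ler1n // ler_peMl ?ler1n.
have XE : X = Fs *m Ls^T + Fw *m Lw^T + E by rewrite /X tr_row_mx mul_row_col.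
have Dib m (C : 'M[R]_(m, s)) c : fnorm C <= c -> fnorm (C *m Di) <= M * ai * c.
  move=> Cc; apply: le_trans (fnorm_diag_mulr_le _ _ dlo) _.
    by rewrite divr_ge0 // sqrtr_ge0.
  by rewrite ler_wpM2l // mulr_ge0.
have cM0 : 0 <= 8 * M ^+ 4 * (s%:R + 2) by rewrite !mulr_ge0 ?exprn_ge0 ?addr_ge0.
have [D2|D2] := leP (fnorm ((1%:M - P) *m Q)) 2^-1.
  have [_ [V [VQ ->]]] := trans_rotation_good Lwu QQ d0 D2.
  (* [orth] lets [(1 - P) Q] replace [Q] after [Ls^T], so the strong factors enter only through the
     subspace error. *)
  have -> : X *m Q *m Di - Fw *m (Lw^T *m V *m Di) =
    (Fs *m (Ls^T *m ((1%:M - P) *m Q)) + Fw *m (Lw^T *m (Q - V)) +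
       (E *m (P *m Q) + E *m ((1%:M - P) *m Q))) *m Di.
    rewrite (mulmxA Fw) -mulmxBl; congr (_ *m _).
    rewrite -mulmxDr (mulmxBl _ P) mul1mx [P *m Q + _]addrC subrK.
    rewrite (mulmxBr Ls^T) (mulmxA Ls^T P) orth mul0mx subr0.
    rewrite !mulmxBr XE !mulmxDl !mulmxA.
    by rewrite [LHS]addrAC; congr (_ + _); rewrite addrA.
  have [Z PZ Zn] := scaled_projP_factor d0 hB Q.
  have lZ : fnorm Z <= s%:R + 2.
    apply: le_of_sqr; first by rewrite addr_ge0.
    by apply: le_trans Zn _; rewrite (fnorm_orthonormal QQ); nra.
  have b1 : fnorm (Fs *m (Ls^T *m ((1%:M - P) *m Q))) <= M * t * (M * n * (M * rho)).
    apply: le_trans (fnormM _ _) _; apply: ler_pM; rewrite ?fnorm_ge0 //.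
    apply: le_trans (fnormM _ _) _; apply: ler_pM; rewrite ?fnorm_ge0 //.
    by rewrite fnorm_trmx.
  have b2 : fnorm (Fw *m (Lw^T *m (Q - V))) <= M * t * (M * n * (2 * (M * rho))).
    apply: le_trans (fnormM _ _) _; apply: ler_pM; rewrite ?fnorm_ge0 //.
    apply: le_trans (fnormM _ _) _; apply: ler_pM; rewrite ?fnorm_ge0 //.
      by rewrite fnorm_trmx.
    rewrite -fnormN opprB; apply: le_trans VQ _.
    by rewrite ler_pM2l.
  have b3 : fnorm (E *m (P *m Q)) <= M * t * (s%:R + 2).
    rewrite PZ mulmxA; apply: le_trans (fnormM _ _) _.
    by apply: ler_pM; rewrite ?fnorm_ge0.
  have b4 : fnorm (E *m ((1%:M - P) *m Q)) <= M * (n * t) * (M * rho).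
    apply: le_trans (fnormM_spec _ _) _.
    by apply: ler_pM; rewrite ?fnorm_ge0 ?specnorm_ge0.
  have tot := le_trans (fnormD _ _) (lerD (le_trans (fnormD _ _) (lerD b1 b2))
    (le_trans (fnormD _ _) (lerD b3 b4))).
  apply: le_trans (Dib _ _ _ tot) _.
  have nt0 : 0 <= t * (n * ai * rho) by rewrite !mulr_ge0.
  have ta0 : 0 <= t * ai by rewrite mulr_ge0.
  have e1 : M * ai * (M * t * (M * n * (M * rho)) + M * t * (M * n * (2 * (M * rho))) +
    (M * t * (s%:R + 2) + M * (n * t) * (M * rho))) =
    (3 * M ^+ 4 + M ^+ 3) * (t * (n * ai * rho)) + M ^+ 2 * (s%:R + 2) * (t * ai) by ring.
  have e2 : 8 * M ^+ 4 * (s%:R + 2) * t * (n * ai * rho + ai) =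
    8 * M ^+ 4 * (s%:R + 2) * (t * (n * ai * rho)) + 8 * M ^+ 4 * (s%:R + 2) * (t * ai)
      by ring.
  rewrite e1 e2; apply: lerD; apply: ler_wpM2r => //.
    have : 0 <= M ^+ 4 * s%:R by rewrite mulr_ge0 ?exprn_ge0.
    have := exprn_ge0 4 Mge0; lra.
  by apply: ler_wpM2r; rewrite ?addr_ge0 //; have := exprn_ge0 4 Mge0; lra.
have -> : H = 1%:M by rewrite /H /trans_rotation leNgt D2.
rewrite invmx1 trmx1 mulmx1.
have b1 : fnorm (X *m Q) <= M * t * (M * n * (s%:R + 1)) + M * t * (M * n * (s%:R + 1))
  + M * (n * t) * (s%:R + 1).
  rewrite XE !mulmxDl -!mulmxA; apply: le_trans (fnormD _ _) _; apply: lerD.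
    apply: le_trans (fnormD _ _) _; apply: lerD; apply: le_trans (fnormM _ _) _;
      apply: ler_pM; rewrite ?fnorm_ge0 //; apply: le_trans (fnormM _ _) _;
      by apply: ler_pM; rewrite ?fnorm_ge0 // fnorm_trmx.
  by apply: le_trans (fnormM_spec _ _) _; apply: ler_pM; rewrite ?fnorm_ge0 ?specnorm_ge0.
apply: le_trans (fnormB _ _) _; apply: le_trans (lerD (Dib _ _ _ b1) lFw) _.
have hr : 1 <= 2 * (M * rho) by have := le_trans (ltW D2) hrho; lra.
(* With [H = 1] a bare [Fw] remains; [a2 <= N] makes it no larger than the other terms. *)
have tna : t <= t * (n * ai) by rewrite ler_peMr.
have tna0 : 0 <= t * (n * ai) by rewrite !mulr_ge0.
apply: (@le_trans _ _ (4 * M ^+ 3 * (s%:R + 2) * (t * (n * ai)))).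
  apply: (@le_trans _ _ ((2 * M ^+ 3 + M ^+ 2) * (s%:R + 1) * (t * (n * ai)) + M * (t *
    (n * ai)))).
    by apply: lerD; [rewrite le_eqVlt; apply/orP; left; apply/eqP; ring|rewrite
      ler_wpM2l].
  rewrite -mulrDl ler_wpM2r //.
  have m23 : M ^+ 2 <= M ^+ 3 by rewrite (exprS M 2) ler_peMl // exprn_ge0.
  have m13 : M <= M ^+ 3 by rewrite (exprS M 2) ler_peMr // exprn_ege1.
  nra.
apply: (@le_trans _ _ (4 * M ^+ 3 * (s%:R + 2) * (t * (n * ai)) * (2 * (M * rho)))).
  by rewrite ler_peMr // !mulr_ge0 ?addr_ge0 ?exprn_ge0.
have -> : 4 * M ^+ 3 * (s%:R + 2) * (t * (n * ai)) * (2 * (M * rho)) =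
   8 * M ^+ 4 * (s%:R + 2) * t * (n * ai * rho) by ring.
by rewrite ler_wpM2l ?lerDl // mulr_ge0.
Qed.

End Transfer.

(** * Bounds in probability *)

Section StochasticBounds.
Context {R : realType} {d : measure_display} {Omega : measurableType d}.
Variable P : probability Omega R.

(* [G M n w] is read as a bound on the outcome [w] at index [n] with constant
   [M]; quantifying over all [M' >= M] makes such bounds stable under
   conjunction. *)
Definition sbounded (G : R -> nat -> Omega -> Prop) := forall e : R, 0 < e ->
  exists2 M : R, 1 <= M & exists n0, forall n, (n0 <= n)%N ->
    exists A, [/\ measurable A, (P A < e%:E)%E &
      forall w, ~ A w -> forall M', M <= M' -> G M' n w].

Lemma sbounded_and G1 G2 : sbounded G1 -> sbounded G2 ->
  sbounded (fun M n w => G1 M n w /\ G2 M n w).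
Proof.
move=> h1 h2 e e0; have e2 : 0 < e / 2 by rewrite divr_gt0.
have [M1 M11 [n1 H1]] := h1 _ e2; have [M2 M21 [n2 H2]] := h2 _ e2.
exists (Num.max M1 M2); first by rewrite le_max M11.
exists (maxn n1 n2) => n; rewrite geq_max => /andP[/H1[A [mA PA HA]] /H2[B [mB PB HB]]].
exists (A `|` B); split; first exact: measurableU.
  apply: (le_lt_trans (measureU2 P mA mB)).
  by rewrite [e]splitr EFinD; exact: lteD.
move=> w /not_orP[nA nB] M'; rewrite ge_max => /andP[M1M M2M].
by split; [exact: HA|exact: HB].
Qed.

(** The index [n0] may depend on the constant [M]. This is what lets a vanishing quantity be
    compared with a power of a constant fixed by the event. *)
Lemma sbounded_imply G G' : sbounded G ->
  (forall M, 1 <= M -> exists2 M', 1 <= M' & exists n0, forall n w,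
     (n0 <= n)%N -> G M n w -> forall M'', M' <= M'' -> G' M'' n w) ->
  sbounded G'.
Proof.
move=> h hG e e0; have [M M1 [n1 H1]] := h _ e0.
have [M' M'1 [n2 H2]] := hG _ M1; exists M' => //; exists (maxn n1 n2) => n.
rewrite geq_max => /andP[/H1[A [mA PA HA]] nn2]; exists A; split => // w nA.
by apply: H2 => //; exact: HA.
Qed.

Lemma sbounded_true G : (forall M n w, G M n w) -> sbounded G.
Proof.
move=> h e e0; exists 1 => //; exists 0%N => n _; exists set0; split => //.
by rewrite measure0 lte_fin.
Qed.

Lemma sbounded_weaken G G' : sbounded G ->
  (forall M n w, G M n w -> G' M n w) -> sbounded G'.
Proof.
move=> h GG e /h[M M1 [n0 H]]; exists M => //; exists n0 => n /H[A [mA PA HA]].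
by exists A; split => // w nA M' MM'; apply: GG; exact: HA.
Qed.

Lemma sbounded_forall K (G : 'I_K -> R -> nat -> Omega -> Prop) :
  (forall k, sbounded (G k)) -> sbounded (fun M n w => forall k, G k M n w).
Proof.
elim: K G => [|K IH] G h; first by apply: sbounded_true => M n w [].
have /IH h1 : forall k, sbounded (G (lift ord0 k)) by move=> k; exact: h.
apply: (sbounded_weaken (sbounded_and (h ord0) h1)) => M n w [g0 g1] k.
by case: (unliftP ord0 k) => [j ->|->].
Qed.

Lemma Op_sbounded X a : (forall n, 0 <= a n) -> Op P X a ->
  sbounded (fun M n w => `|X n w| <= M * a n).
Proof.
move=> a0 h e /h[M [M0 [n0 H]]]; exists (Num.max 1 M); first by rewrite le_max lexx.
exists n0 => n /H[A [mA [AX PA]]]; exists A; split => // w nA M'.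
rewrite ge_max => /andP[_ MM']; apply: (@le_trans _ _ (M * a n)).
  by rewrite leNgt; apply/negP => XM; apply: nA; exact: AX.
by rewrite ler_wpM2r.
Qed.

Lemma sbounded_Op X a :
  sbounded (fun M n w => `|X n w| <= M * a n) -> Op P X a.
Proof.
move=> h e /h[M M1 [n0 H]]; exists M; split; first exact: lt_le_trans M1.
exists n0 => n /H[A [mA PA HA]]; exists A; split => //; split => // w /=.
by move=> XM; apply/not_notP => nA; have := HA w nA M (lexx _); rewrite leNgt XM.
Qed.

Lemma cvg_in_prob_sbounded p q (Y : nat -> Omega -> 'M[R]_(p, q)) L c :
  cvg_in_prob P Y L -> 0 < c -> sbounded (fun _ n w => specnorm (Y n w - L) <= c).
Proof.
move=> h c0 e e0; have [n0 H] := h c e c0 e0; exists 1 => //; exists n0 => n.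
move=> /H[A [mA [AY PA]]]; exists A; split => // w nA M' _.
by rewrite leNgt; apply/negP => YL; apply: nA; exact: AY.
Qed.

Lemma markov_sbounded (X : nat -> Omega -> R) (a : nat -> R) n1 :
  (forall n, measurable_fun setT (X n)) -> (forall n w, 0 <= X n w) ->
  (forall n, (n1 <= n)%N -> 0 < a n) ->
  (forall n, (Expect P (X n) <= (a n)%:E)%E) ->
  sbounded (fun M n w => X n w <= M * a n).
Proof.
(* Markov with this constant bounds the probability by [e / 2]; the summand 1 keeps the constant at
   least 1. *)
move=> mX X0 a0 EX e e0; exists (1 + 2 / e); first by rewrite lerDl divr_ge0 // ltW.
exists n1 => n /a0 an; set c := (1 + 2 / e) * a n.
have c0 : 0 < c by rewrite mulr_gt0 // addr_gt0 // divr_gt0.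
have mg : measurable_fun setT (EFin \o X n) by exact/measurable_EFinP.
have := le_integral_abse P measurableT mg c0.
rewrite setTI; set A := [set x | _].
have mA : measurable A.
  rewrite /A -[X in measurable X]setTI; apply: emeasurable_fun_c_infty => //.
  exact: measurableT_comp.
move=> hA; exists A; split => //; last first.
  move=> w nA M' MM'; apply: (@le_trans _ _ c).
    rewrite leNgt; apply/negP => cX; apply: nA; rewrite /A /=.
    by rewrite lee_fin ger0_norm // ltW.
  by rewrite ler_wpM2r // ltW.
have {}hA : (c%:E * P A <= (a n)%:E)%E.
  apply: le_trans hA _; apply: le_trans (EX n); rewrite /Expect.
  by under eq_integral do rewrite /= ger0_norm ?X0 //.
have PAf : P A \is a fin_num by exact: fin_num_measure.
move: hA; rewrite -(fineK PAf) -EFinM lee_fin lte_fin /c => hA.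
set p := fine (P A) in hA *.
have {}hA : (1 + 2 / e) * p <= 1.
  by rewrite -(ler_pM2r an) mul1r mulrAC.
have p0 : 0 <= p by rewrite /p fine_ge0.
have : 2 / e * p <= 1 by lra.
by rewrite mulrAC ler_pdivrMr // mul1r => h; lra.
Qed.

Lemma Expect_sum_le n (X : 'I_n -> Omega -> R) M :
  (forall i, measurable_fun setT (X i)) -> (forall i w, 0 <= X i w) ->
  (forall i, (Expect P (X i) <= M%:E)%E) ->
  (Expect P (fun w => (\sum_i X i w)%R) <= (n%:R * M)%:E)%E.
Proof.
move=> mX X0 EX; rewrite /Expect.
under eq_integral do rewrite -sumEFin.
rewrite ge0_integral_sum //; last 2 first.
- by move=> i; exact/measurable_EFinP.
- by move=> i w _; rewrite lee_fin.
rewrite (_ : (n%:R * M)%:E = (\sum_(i < n) M%:E)%E); last first.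
  by rewrite sumEFin sumr_const card_ord mulr_natl.
by apply: lee_sum => i _; exact: EX.
Qed.

Definition mx_measurable p q (A : Omega -> 'M[R]_(p, q)) :=
  forall i j, measurable_fun setT (fun w => A w i j).

Lemma mx_measurable_cst p q (A : 'M[R]_(p, q)) : mx_measurable (fun=> A).
Proof. by move=> i j; exact: measurable_cst. Qed.

Lemma mx_measurable_tr p q (A : Omega -> 'M[R]_(p, q)) :
  mx_measurable A -> mx_measurable (fun w => (A w)^T).
Proof.
by move=> mA i j; under eq_fun do rewrite mxE; exact: mA.
Qed.

Lemma mx_measurable_mul p q r (A : Omega -> 'M[R]_(p, q)) (B : Omega -> 'M[R]_(q, r)) :
  mx_measurable A -> mx_measurable B -> mx_measurable (fun w => A w *m B w).
Proof.
move=> mA mB i j; under eq_fun do rewrite mxE.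
by apply: measurable_sum => k; apply: measurable_funM.
Qed.

Lemma mx_measurable_scale p q a (A : Omega -> 'M[R]_(p, q)) :
  mx_measurable A -> mx_measurable (fun w => a *: A w).
Proof.
move=> mA i j; under eq_fun do rewrite mxE.
by apply: measurable_funM => //; exact: measurable_cst.
Qed.

Lemma mx_measurable_row p q (A : Omega -> 'M[R]_(p, q)) i :
  mx_measurable A -> mx_measurable (fun w => row i (A w)).
Proof. by move=> mA k j; under eq_fun do rewrite mxE; exact: mA. Qed.

Lemma mx_measurable_col p q (A : Omega -> 'M[R]_(p, q)) j :
  mx_measurable A -> mx_measurable (fun w => col j (A w)).
Proof. by move=> mA i k; under eq_fun do rewrite mxE; exact: mA. Qed.

Lemma mx_measurable_row_mx p q r (A : Omega -> 'M[R]_(p, q)) (B : Omega -> 'M[R]_(p, r)) :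
  mx_measurable A -> mx_measurable B -> mx_measurable (fun w => row_mx (A w) (B w)).
Proof.
move=> mA mB i j; under eq_fun do rewrite mxE.
by case: (fintype.split j) => k; [exact: mA|exact: mB].
Qed.

Lemma measurable_fnorm_sqr p q (A : Omega -> 'M[R]_(p, q)) :
  mx_measurable A -> measurable_fun setT (fun w => fnorm (A w) ^+ 2).
Proof.
move=> mA; under eq_fun do rewrite fnorm_sqrE.
apply: measurable_sum => i; apply: measurable_sum => j.
by apply: measurable_funX; exact: mA.
Qed.

End StochasticBounds.

(** * Principal components of one panel and aggregation *)

Section Panel.
Context {R : realType} {d : measure_display} {Omega : measurableType d}.
Variable P : probability Omega R.

(** Deterministic asymptotics, with an empty exceptional event, so that they combine with the random
    bounds. *)
Lemma sbounded_det (G : R -> nat -> Prop) M n0 :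
  (forall n M', (n0 <= n)%N -> M <= M' -> 1 <= M' -> G M' n) ->
  sbounded P (fun M n _ => G M n).
Proof.
move=> h e e0; exists (Num.max 1 M); first by rewrite le_max lexx.
exists n0 => n nn0; exists set0; split => //; first by rewrite measure0 lte_fin.
by move=> w _ M'; rewrite ge_max => /andP[h1 h2]; exact: h.
Qed.

Lemma same_order_sbounded (a b : nat -> R) : same_order a b ->
  (forall n, 0 <= a n) -> (forall n, 0 <= b n) ->
  sbounded P (fun M n _ => b n <= M * a n /\ a n <= M * b n).
Proof.
move=> [c [C [c0 [C0 [n0 h]]]]] a0 b0.
apply: (@sbounded_det _ (Num.max c^-1 C) n0) => n M /h[h1 h2].
rewrite ge_max => /andP[cM CM] _; split.
  apply: (@le_trans _ _ (c^-1 * a n)); last by rewrite ler_wpM2r.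
  by rewrite ler_pdivlMl.
by apply: le_trans h2 _; rewrite ler_wpM2r.
Qed.

Lemma diverges_gt0 (u : nat -> nat) : diverges u ->
  exists n0, forall n, (n0 <= n)%N -> (0 < u n)%N.
Proof. exact. Qed.

Variables (N T : nat -> nat) (r : nat).
Variables (F : forall n, Omega -> 'M[R]_(T n, r)).
Variables (E : forall n, Omega -> 'M[R]_(T n, N n)).
Hypotheses (HN : diverges N) (HT : diverges T).

(** Of the lower bound [c] for [Sig], half is spent on the deviation of the Gram matrix. The upper
    bound evaluates the same form at basis vectors, one column of [F] at a time. *)
Lemma gram_sbounded (Sig : 'M[R]_r) :
  cvg_in_prob P (fun n w => (T n)%:R^-1 *: ((F n w)^T *m F n w)) Sig ->
  posdef Sig ->
  sbounded P (fun M n w =>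
    (forall y : 'cV[R]_r, M^-1 * (T n)%:R * fnorm y ^+ 2 <= fnorm (F n w *m y) ^+ 2)
    /\ fnorm (F n w) ^+ 2 <= M * (T n)%:R).
Proof.
move=> HF /posdef_lower[c c0 Sc].
have c20 : 0 < c / 2 by rewrite divr_gt0.
have [n0 Tn0] := diverges_gt0 HT.
apply: (sbounded_imply (cvg_in_prob_sbounded HF c20)) => M0 _.
pose C := (fnorm Sig + c / 2) * r%:R.
have C0 : 0 <= C by rewrite mulr_ge0 // addr_ge0 ?fnorm_ge0 // ltW.
exists (1 + 2 / c + C).
  by rewrite -addrA lerDl addr_ge0 // divr_ge0 // ltW.
exists n0 => n w /Tn0; rewrite -(ltr0n R) => T0 HS M HM.
have M0' : 0 < M by have := divr_ge0 (ler0n R 2) (ltW c0); lra.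
set D := _ - Sig in HS.
have quad (y : 'cV[R]_r) : fnorm (F n w *m y) ^+ 2 =
    (T n)%:R * ((y^T *m Sig *m y) 0 0 + (y^T *m D *m y) 0 0).
  rewrite -addmxE -mulmxDl -mulmxDr [Sig + D]addrC subrK -scalemxAr -scalemxAl scalemxE.
  rewrite mulrA mulfV ?gt_eqF // mul1r fnorm_sqr_cV trmx_mul.
  by rewrite !mulmxA.
have Dy (y z : 'cV[R]_r) : fnorm z = fnorm y ->
    - (fnorm y * (c / 2 * fnorm y)) <= (z^T *m D *m y) 0 0.
  move=> zy; rewrite -mulmxA; apply: cV_trmul_ge; first by rewrite zy.
  by apply: le_trans (fnormM_spec _ _) _; rewrite ler_wpM2r ?fnorm_ge0.
split=> [y|].
  rewrite quad (mulrC M^-1) -mulrA ler_pM2l //.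
  have := Sc y; have := Dy y y erefl; have := sqr_ge0 (fnorm y).
  have : M^-1 <= c / 2.
    rewrite -[c / 2]invrK lef_pV2 ?posrE ?invr_gt0 //.
    by rewrite invf_div; lra.
  move=> h1 h2 h3 h4.
  have : M^-1 * fnorm y ^+ 2 <= c / 2 * fnorm y ^+ 2 by rewrite ler_wpM2r.
  lra.
apply: (@le_trans _ _ (C * (T n)%:R)); last first.
  by rewrite ler_wpM2r //; have := divr_ge0 (ler0n R 2) (ltW c0); lra.
rewrite fnorm_cols /C mulrAC mulr_natr.
apply: (@le_trans _ _ (\sum_(j < r) (fnorm Sig + c / 2) * (T n)%:R)); last first.
  by rewrite sumr_const card_ord.
apply: ler_sum => j _; rewrite colE quad mulrC ler_wpM2r ?ler0n //.
set y := delta_mx j 0.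
have y1 : fnorm y = 1.
  apply/eqP; rewrite -(eqrXn2 (n := 2)) ?fnorm_ge0 // expr1n fnorm_sqr_cV.
  by rewrite trmx_delta mul_delta_mx mxE !eqxx.
have := Dy y (- y) (fnormN _); rewrite y1 linearN /= !mulNmx oppmxE.
have : (y^T *m Sig *m y) 0 0 <= fnorm Sig.
  have : - (1 * fnorm Sig) <= ((- y)^T *m (Sig *m y)) 0 0.
    apply: cV_trmul_ge; first by rewrite fnormN y1.
    by apply: le_trans (fnormM _ _) _; rewrite y1 mulr1.
  by rewrite linearN /= mulNmx oppmxE mul1r lerN2 mulmxA.
lra.
Qed.

(** The squared norm is [T] times a sum over the [N] series whose terms (A4) bounds in expectation.
    Markov is applied once, to the whole sum, so no union of [N] events occurs. *)
Lemma cross_sbounded M :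
  (forall n i j, measurable_fun setT (fun w => F n w i j)) ->
  (forall n i j, measurable_fun setT (fun w => E n w i j)) ->
  (forall n (i : 'I_(N n)),
     (Expect P (fun w => (fnorm ((Num.sqrt (T n)%:R)^-1 *:
          ((F n w)^T *m col i (E n w))) ^+ 2)%R) <= M%:E)%E) ->
  sbounded P (fun M n w =>
    fnorm ((E n w)^T *m F n w) ^+ 2 <= M * ((N n)%:R * (T n)%:R)).
Proof.
move=> mF mE HM.
have [nN HN0] := diverges_gt0 HN; have [nT HT0] := diverges_gt0 HT.
pose M1 := Num.max 1 M; have M11 : 1 <= M1 by rewrite le_max lexx.
pose Y n (i : 'I_(N n)) w := fnorm ((Num.sqrt (T n)%:R)^-1 *:
          ((F n w)^T *m col i (E n w))) ^+ 2.
have mY n i : measurable_fun setT (Y n i).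
  apply: measurable_fnorm_sqr; apply: mx_measurable_scale.
  apply: mx_measurable_mul; first exact: mx_measurable_tr (mF n).
  exact: mx_measurable_col (mE n).
have Y0 n i w : 0 <= Y n i w by exact: sqr_ge0.
have := @markov_sbounded _ _ _ P (fun n w => \sum_i Y n i w)
  (fun n => (N n)%:R * M1) nN.
move=> /(_ _ _ _ _)/wrap[].
- by move=> n; apply: measurable_sum => i; exact: mY.
- by move=> n w; apply: sumr_ge0 => i _.
- by move=> n /HN0 N0; rewrite mulr_gt0 ?ltr0n // (lt_le_trans ltr01).
- move=> n; apply: Expect_sum_le => // i; apply: le_trans (HM n i) _.
  by rewrite lee_fin le_max lexx orbT.
move=> h; apply: (sbounded_imply h) => C C1; exists (C * M1).
  by rewrite mulr_ege1.
exists nT => n w /HT0; rewrite -(ltr0n R) => T0 hY C' CC'.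
have -> : fnorm ((E n w)^T *m F n w) ^+ 2 = (T n)%:R * \sum_i Y n i w.
  rewrite -fnorm_trmx trmx_mul trmxK fnorm_cols mulr_sumr; apply: eq_bigr => i _.
  rewrite /Y fnormZ ger0_norm ?invr_ge0 ?sqrtr_ge0 // exprMn exprVn.
  rewrite (sqr_sqrtr (ltW T0)) mulrA mulfV ?gt_eqF // mul1r.
  by rewrite !colE mulmxA.
rewrite mulrA [leRHS]mulrC ler_pM2l //; apply: le_trans hY _.
by rewrite mulrCA [leRHS]mulrC ler_wpM2l.
Qed.

(** The same scheme over time points, meant for [A] the transposed normalised target loadings. *)
Lemma weighted_sbounded p (A : forall n, 'M[R]_(p, N n)) M :
  (forall n i j, measurable_fun setT (fun w => E n w i j)) ->
  (forall n (t : 'I_(T n)),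
     (Expect P (fun w => (fnorm (A n *m (row t (E n w))^T) ^+ 2)%R) <= M%:E)%E) ->
  sbounded P (fun M n w => fnorm (E n w *m (A n)^T) ^+ 2 <= M * (T n)%:R).
Proof.
move=> mE HM; have [nT HT0] := diverges_gt0 HT.
pose M1 := Num.max 1 M; have M11 : 1 <= M1 by rewrite le_max lexx.
pose Y n (t : 'I_(T n)) w := fnorm (A n *m (row t (E n w))^T) ^+ 2.
have mY n i : measurable_fun setT (Y n i).
  apply: measurable_fnorm_sqr; apply: mx_measurable_mul.
    exact: mx_measurable_cst.
  apply: mx_measurable_tr; exact: mx_measurable_row (mE n).
have Y0 n i w : 0 <= Y n i w by exact: sqr_ge0.
have := @markov_sbounded _ _ _ P (fun n w => \sum_i Y n i w)
  (fun n => (T n)%:R * M1) nT.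
move=> /(_ _ _ _ _)/wrap[].
- by move=> n; apply: measurable_sum => i; exact: mY.
- by move=> n w; apply: sumr_ge0 => i _.
- by move=> n /HT0 T0; rewrite mulr_gt0 ?ltr0n // (lt_le_trans ltr01).
- move=> n; apply: Expect_sum_le => // i; apply: le_trans (HM n i) _.
  by rewrite lee_fin le_max lexx orbT.
move=> h; apply: (sbounded_imply h) => C C1; exists (C * M1).
  by rewrite mulr_ege1.
exists 0%N => n w _ hY C' CC'.
have -> : fnorm (E n w *m (A n)^T) ^+ 2 = \sum_i Y n i w.
  rewrite fnorm_rows; apply: eq_bigr => i _.
  by rewrite /Y -[fnorm (A n *m _)]fnorm_trmx trmx_mul trmxK row_mul.
apply: le_trans hY _.
by rewrite mulrCA [leRHS]mulrC ler_wpM2l.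
Qed.

(** One statement for all panels: [dl] and [g] are the diagonal of [D] and [N^alpha_s] for the
    target, and are both given by [N] for a source. *)
Lemma projection_sbounded (L : forall n, 'M[R]_(N n, r))
    (Q : forall n, Omega -> 'M[R]_(N n, r)) (dl : nat -> 'rV[R]_r)
    (g : nat -> R) nB ng :
  sbounded P (fun M n w =>
    (forall y : 'cV[R]_r, M^-1 * (T n)%:R * fnorm y ^+ 2 <= fnorm (F n w *m y) ^+ 2)
    /\ fnorm (F n w) ^+ 2 <= M * (T n)%:R) ->
  sbounded P (fun M n w =>
    fnorm ((E n w)^T *m F n w) ^+ 2 <= M * ((N n)%:R * (T n)%:R)) ->
  sbounded P (fun M n w => specnorm (E n w) ^+ 2 <= M * Num.max (N n)%:R (T n)%:R) ->
  (forall n i, 0 < dl n 0 i) ->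
  sbounded P (fun M n _ => forall i, g n <= M * dl n 0 i /\ dl n 0 i <= M * (N n)%:R) ->
  (forall n, (nB <= n)%N ->
     near_isometry (L n *m diag_mx (\row_i (Num.sqrt (dl n 0 i))^-1))) ->
  (forall n, (ng <= n)%N -> 0 < g n) ->
  tends0 (fun n => (N n)%:R / (Num.sqrt (T n)%:R * g n)) ->
  (forall n w, leading_eigvecs (((N n)%:R * (T n)%:R)^-1 *:
     ((F n w *m (L n)^T + E n w)^T *m (F n w *m (L n)^T + E n w))) (Q n w)) ->
  sbounded P (fun M n w => fnorm (Q n w *m (Q n w)^T - projP (L n)) <=
    M * ((N n)%:R / (Num.sqrt (T n)%:R * g n) + (g n)^-1)).
Proof.
move=> hF hEF hE dl0 hd hB hg hsm hQ.
have [nN HN0] := diverges_gt0 HN; have [nT HT0] := diverges_gt0 HT.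
apply: (sbounded_imply (sbounded_and (sbounded_and hF hd) (sbounded_and hEF hE))).
(* One constant for all hypotheses of [pca_bound]: the 8 comes from [scaled_gram_ge], and [r + 1]
   covers the norm bound [2 r M N] for [L]. *)
move=> M M1; pose Mp := 8 * M * (r%:R + 1).
have r0 := ler0n R r.
have MMp : 8 * M <= Mp by rewrite /Mp ler_peMr ?lerDr //; lra.
have Mp1 : 1 <= Mp by lra.
have M0 : 0 < M by lra.
have Mp0 : 0 < Mp by lra.
have e0 : 0 < (4 * Mp ^+ 3)^-1 by rewrite invr_gt0 mulr_gt0 // exprn_gt0.
have [ns Hs] := hsm _ e0.
exists (4 * Mp ^+ 3 * (r%:R + 1)).
  have : 1 <= Mp ^+ 3 by exact: exprn_ege1.
  by move=> h; nra.
exists (maxn (maxn nN nT) (maxn (maxn nB ng) ns)) => n w.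
rewrite !geq_max => /andP[/andP[/HN0 N0 /HT0 T0] /andP[/andP[/hB nB' /hg gn] /Hs sm]].
move=> [[[HF1 HF2] Hd] [HEF HE]] M' HM'.
have T0' : 0 < (T n)%:R :> R by rewrite ltr0n.
have N0' : 0 < (N n)%:R :> R by rewrite ltr0n.
have st0 : 0 < Num.sqrt (T n)%:R :> R by rewrite sqrtr_gt0.
have rate0 : 0 <= (N n)%:R / (Num.sqrt (T n)%:R * g n) + (g n)^-1.
  by rewrite addr_ge0 ?divr_ge0 ?mulr_ge0 ?invr_ge0 // ltW.
apply: le_trans (ler_wpM2r rate0 HM').
have MMp' : M <= Mp by lra.
have iMp : Mp^-1 <= M^-1 by rewrite lef_pV2.
apply: pca_bound (hQ n w) => //.
- move=> y; apply: le_trans (HF1 y); rewrite ler_wpM2r ?sqr_ge0 // ler_wpM2r //.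
- by apply: le_trans HEF _; rewrite ler_wpM2r // mulr_ge0.
- by apply: le_trans HE _; rewrite ler_wpM2r // le_max ltW.
- apply: le_trans (scaled_fnorm (dl0 n) nB' _ (fun j => (Hd j).2)) _.
    by rewrite mulr_ge0 // ltW.
  rewrite mulrA ler_wpM2r // /Mp; nra.
- exact: scaled_gram_unitmx (dl0 n) nB'.
- move=> y; apply: le_trans (scaled_gram_ge (dl0 n) nB' y (a := M^-1 * g n) _ _).
  + rewrite mulrA ler_wpM2r ?sqr_ge0 // ler_wpM2r ?(ltW gn) // -invfM lef_pV2 ?posrE //.
    by rewrite mulr_gt0.
  + by rewrite mulr_ge0 ?invr_ge0 // ltW.
  + by move=> j; rewrite ler_pdivrMl //; exact: (Hd j).1.
- by apply: le_trans sm; exact: ler_norm.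
Qed.

End Panel.

Section Aggregation.
Context {R : realType}.
Variables (N K : nat) (P0 Pw Ps : 'M[R]_N) (Pk PT PC : 'I_K -> 'M[R]_N).
Variables (t0 e : R) (t : 'I_K -> R).
Let tot := t0 + \sum_k t k.
Let S := tot^-1 *: (t0 *: Ps + \sum_k t k *: PC k).
Hypotheses (t0_gt0 : 0 < t0) (t_ge0 : forall k, 0 <= t k).

Let tot_gt0 : 0 < tot.
Proof. by rewrite /tot ltr_wpDr // sumr_ge0. Qed.

Hypothesis hT : forall k, fnorm (PT k - Pw) <= e.

(** The weights sum to one, so [Pw] can be distributed over the panels and each panel compared with
    its own limit. *)
Lemma aggregate_error :
  fnorm (tot^-1 *: (t0 *: P0 + \sum_k t k *: Pk k) - Pw - S) <=
    tot^-1 * (t0 * fnorm (P0 - (Pw + Ps)) +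
      \sum_k t k * (fnorm (Pk k - (PT k + PC k)) + e)).
Proof.
have -> : tot^-1 *: (t0 *: P0 + \sum_k t k *: Pk k) - Pw - S =
    tot^-1 *: (t0 *: (P0 - (Pw + Ps)) +
      \sum_k t k *: ((Pk k - (PT k + PC k)) + (PT k - Pw))).
  have PwE : Pw = tot^-1 *: (t0 *: Pw + \sum_k t k *: Pw).
    by rewrite -scaler_suml -scalerDl scalerA mulVf ?scale1r // gt_eqF.
  rewrite {1}PwE /S -!scalerBr; congr (_ *: _).
  have PkE k : Pk k - (PT k + PC k) + (PT k - Pw) = Pk k - Pw - PC k.
    by apply/matrixP => i j; rewrite !mxE; ring.
  under [in RHS]eq_bigr => k _ do rewrite PkE.
  under [in RHS]eq_bigr => k _ do rewrite !scalerBr.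
  rewrite !sumrB scalerBr scalerDr.
  by apply/matrixP => i j; rewrite !mxE; ring.
rewrite fnormZ ger0_norm ?invr_ge0 ?(ltW tot_gt0) //.
rewrite ler_pM2l ?invr_gt0 //; apply: le_trans (fnormD _ _) _; apply: lerD.
  by rewrite fnormZ ger0_norm // ltW.
apply: le_trans (fnorm_sum _) _; apply: ler_sum => k _.
rewrite fnormZ ger0_norm // ler_wpM2l //; apply: le_trans (fnormD _ _) _.
by rewrite lerD2l.
Qed.

(** [PC k] annihilates [PT k], hence [PC k Pw = - PC k (PT k - Pw)], of norm at most [e]. *)
Lemma aggregate_cross : orthproj Pw -> Ps *m Pw = 0 ->
  (forall k, orthproj (PC k)) -> (forall k, PC k *m PT k = 0) ->
  fnorm (S *m Pw) <= tot^-1 * \sum_k t k * e.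
Proof.
move=> Pwp PsPw PCp PCT; rewrite /S -scalemxAl mulmxDl -scalemxAl PsPw scaler0 add0r.
rewrite fnormZ ger0_norm ?invr_ge0 ?(ltW tot_gt0) // ler_pM2l ?invr_gt0 //.
rewrite mulmx_suml; apply: le_trans (fnorm_sum _) _; apply: ler_sum => k _.
rewrite -scalemxAl fnormZ ger0_norm // ler_wpM2l //.
have -> : PC k *m Pw = - (PC k *m (PT k - Pw)) by rewrite mulmxBr PCT sub0r opprK.
by rewrite fnormN; apply: le_trans (hT k); exact: fnorm_orthproj_le.
Qed.

End Aggregation.

(** * Block loadings, simplification of the rate, splitting of an O_p bound *)

Section Assembly.
Context {R : realType}.

Lemma mul_row_mx_diag m p q (A : 'M[R]_(m, p)) (B : 'M[R]_(m, q)) (f : R -> R)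
    (u : 'rV[R]_p) (v : 'rV[R]_q) :
  row_mx A B *m diag_mx (\row_i f (row_mx u v 0 i)) =
  row_mx (A *m diag_mx (\row_i f (u 0 i))) (B *m diag_mx (\row_i f (v 0 i))).
Proof.
apply/matrixP => i j; rewrite mul_mx_diag !mxE.
by case: (splitP j) => k jk; rewrite mul_mx_diag !mxE.
Qed.

Section Blocks.
Variables (m p q : nat) (A : 'M[R]_(m, p)) (B : 'M[R]_(m, q)).
Variables (u : 'rV[R]_p) (v : 'rV[R]_q).
Hypotheses (u0 : forall i, 0 < u 0 i) (v0 : forall i, 0 < v 0 i).
Hypothesis hAB : near_isometry
  (row_mx A B *m diag_mx (\row_i (Num.sqrt (row_mx u v 0 i))^-1)).

Lemma block_near_isometryl :
  near_isometry (A *m diag_mx (\row_i (Num.sqrt (u 0 i))^-1)).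
Proof.
move: hAB; rewrite (mul_row_mx_diag A B (fun x => (Num.sqrt x)^-1)).
exact: near_isometry_row_mxl.
Qed.

Lemma block_near_isometryr :
  near_isometry (B *m diag_mx (\row_i (Num.sqrt (v 0 i))^-1)).
Proof.
move: hAB; rewrite (mul_row_mx_diag A B (fun x => (Num.sqrt x)^-1)).
exact: near_isometry_row_mxr.
Qed.

Lemma block_projP_orth : projP (row_mx A B) = projP A + projP B ->
  projP A *m projP B = 0.
Proof.
move=> hP; apply: orthproj_add_orth.
- exact: orthproj_projP (scaled_gram_unitmx u0 block_near_isometryl).
- exact: orthproj_projP (scaled_gram_unitmx v0 block_near_isometryr).
- rewrite -hP; apply: orthproj_projP; apply: (scaled_gram_unitmx _ hAB) => i.
  by rewrite mxE; case: (splitP i).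
Qed.

End Blocks.

(** The sign of [e] is assumed only in the presence of a source, because (A5) says nothing about
    [eps] when [K = 0]. *)
Lemma rate_bound K (t0 tot N g e M : R) (t : 'I_K -> R) :
  0 < t0 -> (forall k, 0 < t k) -> 0 < tot -> 0 < N -> 0 < g -> 1 <= M ->
  ('I_K -> 0 <= e) ->
  tot^-1 * (t0 * (M * (N / (Num.sqrt t0 * g) + g^-1)) +
    \sum_k t k * (M * (N / (Num.sqrt (t k) * N) + N^-1) + e)) <=
  M * (Num.sqrt t0 * N / (tot * g) + t0 / (tot * g) +
    \sum_(k < K) (Num.sqrt (t k) / tot + t k / (tot * N)) +
    tot^-1 * \sum_(k < K) (t k * e)).
Proof.
move=> t0_gt0 t_gt0 tot0 N0 g0 M1 e0.
have s0 : 0 < Num.sqrt t0 by rewrite sqrtr_gt0.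
have sE := sqr_sqrtr (ltW t0_gt0).
rewrite mulrDr [leRHS]mulrDr [in leRHS]mulrDr -addrA; apply: lerD.
  rewrite le_eqVlt; apply/orP; left; apply/eqP.
  by rewrite -{1 4}sE; field; rewrite !gt_eqF.
rewrite !mulr_sumr -big_split; apply: ler_sum => k _ /=.
have sk0 : 0 < Num.sqrt (t k) by rewrite sqrtr_gt0.
have skE := sqr_sqrtr (ltW (t_gt0 k)).
rewrite mulrDr mulrDr; apply: lerD.
  rewrite le_eqVlt; apply/orP; left; apply/eqP.
  by rewrite -{1 4}skE; field; rewrite !gt_eqF.
rewrite ler_peMl // mulr_ge0 ?invr_ge0 ?(ltW tot0) // mulr_ge0 ?(ltW (t_gt0 k)) //.
exact: e0.
Qed.

(** The source analogue of (A6)(1): with strength [N] the ratio is [1 / sqrt T], or [0 / 0 = 0] when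
    [N n = 0]. *)
Lemma small_source (N T : nat -> nat) : diverges T ->
  tends0 (fun n => (N n)%:R / (Num.sqrt (T n)%:R * (N n)%:R) : R).
Proof.
move=> hT e e0; have [n0 H] := hT (Num.bound (e ^+ 2)^-1).+1.
exists n0 => n /H Tn.
have hb : (e ^+ 2)^-1 < (T n)%:R.
  apply: lt_le_trans (archi_boundP _) _; first by rewrite invr_ge0 sqr_ge0.
  by rewrite ler_nat ltnW.
have T0 : 0 < (T n)%:R :> R by apply: le_lt_trans hb; rewrite invr_ge0 sqr_ge0.
have st0 : 0 < Num.sqrt (T n)%:R :> R by rewrite sqrtr_gt0.
have [N0|N0] := eqVneq ((N n)%:R : R) 0; first by rewrite N0 mul0r normr0 ltW.
rewrite invfM mulrCA mulfV // mulr1 ger0_norm ?invr_ge0 ?(ltW st0) //.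
rewrite invf_ple ?posrE //; apply: le_of_sqr; first exact: ltW.
by rewrite exprVn sqr_sqrtr ltW.
Qed.

Context {d : measure_display} {Omega : measurableType d}.
Variable P : probability Omega R.

(** [t] is shared out in proportion to [a] and [b]. Defining the second part as the remainder keeps
    the identity exact even where [a n + b n = 0]. *)
Lemma Op_split (t : nat -> Omega -> R) (a b : nat -> R) n0 :
  (forall n, 0 <= a n) -> (forall n, 0 <= b n) ->
  (forall n, (n0 <= n)%N -> 0 < b n) ->
  sbounded P (fun M n w => `|t n w| <= M * (a n + b n)) ->
  exists Y Z : nat -> Omega -> R,
    [/\ forall n w, t n w = Y n w + Z n w, Op P Y a & Op P Z b].
Proof.
move=> a0 b0 hb ht.
exists (fun n w => t n w * (a n / (a n + b n))).
exists (fun n w => t n w - t n w * (a n / (a n + b n))).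
split=> [n w||]; first by rewrite addrC subrK.
  apply: sbounded_Op; apply: (sbounded_imply ht) => M M1; exists M => //.
  exists n0 => n w /hb bn tn M' MM'.
  have ab : 0 < a n + b n by rewrite ltr_wpDl.
  rewrite normrM [`|a n / _|]ger0_norm ?divr_ge0 ?(ltW ab) //.
  rewrite mulrA ler_pdivrMr // mulrAC ler_wpM2r //.
  by apply: le_trans tn _; rewrite ler_wpM2r // ltW.
apply: sbounded_Op; apply: (sbounded_imply ht) => M M1; exists M => //.
exists n0 => n w /hb bn tn M' MM'.
have ab : 0 < a n + b n by rewrite ltr_wpDl.
have -> : t n w - t n w * (a n / (a n + b n)) = t n w * (b n / (a n + b n)).
  by field; rewrite gt_eqF.
rewrite normrM [`|b n / _|]ger0_norm ?divr_ge0 ?(ltW ab) //.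
rewrite mulrA ler_pdivrMr // mulrAC ler_wpM2r //.
by apply: le_trans tn _; rewrite ler_wpM2r // ltW.
Qed.

End Assembly.

(** * The model assumptions turned into one event, and the two estimates on it *)

Theorem theorem1
  (R : realType) (d : measure_display) (Omega : measurableType d)
  (P : probability Omega R)
  (* K informative sources (the set A, relabelled as 'I_K); s weak factors;
     r0s = r_0 - s strong target factors; rc k = r_k - s for source k *)
  (K s : nat) (hs : (0 < s)%N) (r0s : nat) (rc : 'I_K -> nat)
  (* asymptotic index n : N = N n, T_0 = T0 n, T_k = Tk k n *)
  (N T0 : nat -> nat) (Tk : 'I_K -> nat -> nat)
  (alpha : 'I_s -> R) (eps : nat -> R) (M : R)
  (* target loadings (strong, weak), factors, errors *)
  (Ls : forall n, 'M[R]_(N n, r0s)) (Lw : forall n, 'M[R]_(N n, s))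
  (F0s : forall n, Omega -> 'M[R]_(T0 n, r0s))
  (F0w : forall n, Omega -> 'M[R]_(T0 n, s))
  (E0 : forall n, Omega -> 'M[R]_(T0 n, N n))
  (* source loadings (Lambda_T, Lambda_T^c), factors, errors *)
  (LT : forall n (k : 'I_K), 'M[R]_(N n, s))
  (LTc : forall n (k : 'I_K), 'M[R]_(N n, rc k))
  (Fk : forall n (k : 'I_K), Omega -> 'M[R]_(Tk k n, s + rc k))
  (Ek : forall n (k : 'I_K), Omega -> 'M[R]_(Tk k n, N n))
  (* diagonal of D = diag(D_s, D_w) *)
  (dS : nat -> 'rV[R]_r0s) (dW : nat -> 'rV[R]_s)
  (* limits Sigma_F *)
  (Sig0 : 'M[R]_(r0s + s)) (Sigk : forall k : 'I_K, 'M[R]_(s + rc k))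
  (* eigenvector choices of the oracle TransPCA procedure *)
  (Qhat0 : forall n, Omega -> 'M[R]_(N n, r0s + s))
  (Qhatk : forall n (k : 'I_K), Omega -> 'M[R]_(N n, s + rc k))
  (Qw : forall n, Omega -> 'M[R]_(N n, s)) :
  let Nr := fun n => (N n)%:R : R in
  let T0r := fun n => (T0 n)%:R : R in
  let Tkr := fun (k : 'I_K) n => (Tk k n)%:R : R in
  let Ttot := fun n => T0r n + \sum_(k < K) Tkr k n in
  let L0 := fun n => row_mx (Ls n) (Lw n) in
  let F0 := fun n w => row_mx (F0s n w) (F0w n w) in
  let X0 := fun n w => F0 n w *m (L0 n)^T + E0 n w in
  let Lk := fun n k => row_mx (LT n k) (LTc n k) in
  let Xk := fun n k w => Fk n k w *m (Lk n k)^T + Ek n k w in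
  let dvec := fun n => row_mx (dS n) (dW n) in
  let Dis := fun n => diag_mx (\row_i (Num.sqrt (dvec n 0 i))^-1) in
  let alpha1 := alpha (ord_first hs) in
  let alphas := alpha (ord_last hs) in
  let Phat := fun n w => (Ttot n)^-1 *:
      (T0r n *: (Qhat0 n w *m (Qhat0 n w)^T)
       + \sum_(k < K) Tkr k n *: (Qhatk n k w *m (Qhatk n k w)^T)) in
  let Lamhat := fun n w => Qw n w *m diag_mx (map_mx Num.sqrt (dW n)) in
  let Fhat := fun n w => X0 n w *m Lamhat n w *m invmx (diag_mx (dW n)) in
  let rate := fun n =>
      Num.sqrt (T0r n) * Nr n / (Ttot n * Nr n `^ alphas)
      + T0r n / (Ttot n * Nr n `^ alphas)
      + \sum_(k < K) (Num.sqrt (Tkr k n) / Ttot n + Tkr k n / (Ttot n * Nr n))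
      + (Ttot n)^-1 * \sum_(k < K) (Tkr k n * eps n) in
  (* asymptotic regime: N -> oo and min_k T_k -> oo *)
  diverges N -> diverges T0 -> (forall k, diverges (Tk k)) ->
  (* random quantities are random variables *)
  (forall n i j, measurable_fun setT (fun w => F0s n w i j)) ->
  (forall n i j, measurable_fun setT (fun w => F0w n w i j)) ->
  (forall n i j, measurable_fun setT (fun w => E0 n w i j)) ->
  (forall n k i j, measurable_fun setT (fun w => Fk n k w i j)) ->
  (forall n k i j, measurable_fun setT (fun w => Ek n k w i j)) ->
  (* structure of the loadings *)
  (forall n, projP (L0 n) = projP (Lw n) + projP (Ls n)) ->
  (forall n k, projP (Lk n k) = projP (LT n k) + projP (LTc n k)) ->
  (* (A1) *)
  (forall n (t : 'I_(T0 n)),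
     (Expect P (fun w => (fnorm (row t (F0 n w)) ^+ 4)%R) <= M%:E)%E) ->
  (forall n k (t : 'I_(Tk k n)),
     (Expect P (fun w => (fnorm (row t (Fk n k w)) ^+ 4)%R) <= M%:E)%E) ->
  cvg_in_prob P (fun n w => (T0r n)^-1 *: ((F0 n w)^T *m F0 n w)) Sig0 ->
  (forall k, cvg_in_prob P
     (fun n w => (Tkr k n)^-1 *: ((Fk n k w)^T *m Fk n k w)) (Sigk k)) ->
  posdef Sig0 -> distinct_eigs Sig0 ->
  (forall k, posdef (Sigk k)) -> (forall k, distinct_eigs (Sigk k)) ->
  (* (A2) *)
  (forall n, maxnorm (L0 n) <= M) ->
  (forall n k, maxnorm (Lk n k) <= M) ->
  (forall n i, 0 < dS n 0 i) -> (forall n i, 0 < dW n 0 i) ->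
  (forall i, same_order (fun n => dS n 0 i) Nr) ->
  (forall i, same_order (fun n => dW n 0 i) (fun n => Nr n `^ alpha i)) ->
  (forall i, 0 < alpha i < 1) ->
  (forall i j : 'I_s, (i <= j)%N -> alpha j <= alpha i) ->
  tends0 (fun n => specnorm (Dis n *m (L0 n)^T *m L0 n *m Dis n - 1%:M)) ->
  (forall k, tends0 (fun n =>
     specnorm ((Nr n)^-1 *: ((Lk n k)^T *m Lk n k) - 1%:M))) ->
  (* (A3) *)
  Op P (fun n w => specnorm (E0 n w) ^+ 2) (fun n => Num.max (Nr n) (T0r n)) ->
  (forall k, Op P (fun n w => specnorm (Ek n k w) ^+ 2)
                 (fun n => Num.max (Nr n) (Tkr k n))) ->
  (* (A4) *)
  (forall n (t : 'I_(T0 n)),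
     (Expect P (fun w => (fnorm (Dis n *m (L0 n)^T *m (row t (E0 n w))^T) ^+ 2)%R)
        <= M%:E)%E) ->
  (forall n k (t : 'I_(Tk k n)),
     (Expect P (fun w => (fnorm ((Num.sqrt (Nr n))^-1 *:
          ((Lk n k)^T *m (row t (Ek n k w))^T)) ^+ 2)%R) <= M%:E)%E) ->
  (forall n (i : 'I_(N n)),
     (Expect P (fun w => (fnorm ((Num.sqrt (T0r n))^-1 *:
          ((F0 n w)^T *m col i (E0 n w))) ^+ 2)%R) <= M%:E)%E) ->
  (forall n k (i : 'I_(N n)),
     (Expect P (fun w => (fnorm ((Num.sqrt (Tkr k n))^-1 *:
          ((Fk n k w)^T *m col i (Ek n k w))) ^+ 2)%R) <= M%:E)%E) ->
  (* (A5) *)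
  (forall n k, fnorm (projP (LT n k) - projP (Lw n)) <= eps n) ->
  (exists kappa : R, 0 < kappa /\ forall n,
     (Ttot n)^-1 * specnorm (T0r n *: projP (Ls n)
        + \sum_(k < K) Tkr k n *: projP (LTc n k)) <= 1 - kappa) ->
  (* (A6)(1) *)
  tends0 (fun n => Nr n / (Num.sqrt (T0r n) * Nr n `^ alphas)) ->
  (* oracle TransPCA eigenvector steps *)
  (forall n w, leading_eigvecs
     ((Nr n * T0r n)^-1 *: ((X0 n w)^T *m X0 n w)) (Qhat0 n w)) ->
  (forall n k w, leading_eigvecs
     ((Nr n * Tkr k n)^-1 *: ((Xk n k w)^T *m Xk n k w)) (Qhatk n k w)) ->
  (forall n w, leading_eigvecs (Phat n w) (Qw n w)) ->
  (* conclusion *)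
  exists H : forall n, Omega -> 'M[R]_s,
    (forall n w, H n w \in unitmx) /\
    Op P (fun n w => specnorm (Lamhat n w - Lw n *m H n w) / Num.sqrt (Nr n))
         (fun n => Num.sqrt (Nr n `^ alpha1) / Num.sqrt (Nr n) * rate n) /\
    exists Y Z : nat -> Omega -> R,
      (forall n w, specnorm (Fhat n w - F0w n w *m (invmx (H n w))^T)
                     / Num.sqrt (T0r n) = Y n w + Z n w) /\
      Op P Y (fun n => Num.sqrt (Nr n) / Num.sqrt (Nr n `^ alphas) * rate n) /\
      Op P Z (fun n => 1 / Num.sqrt (Nr n `^ alphas)).
Proof.
move=> Nr T0r Tkr Ttot L0 F0 X0 Lk Xk dvec Dis alpha1 alphas Phat Lamhat Fhat rate.
move=> HN HT0 HTk mFs mFw mE mFk mEk HP0 HPk _ _ HF0 HFk pd0 _ pdk _ _ _ dS0 dW0.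
move=> soS soW al01 alm HL0 HLk HE0 HEk HA4 _ HC0 HCk HA5 [kap [kap0 HK]] HA6 hQ0 hQk hQw.
pose g n := Nr n `^ alphas.
have [nN HN0] := diverges_gt0 HN.
have Ng0 n : (0 < N n)%N -> 0 < g n by move=> n0; rewrite powR_gt0 // ltr0n.
have Ng1 n (i : 'I_s) : (0 < N n)%N -> g n <= Nr n `^ alpha i.
  move=> n0; apply: ler_powR; first by rewrite ler1n.
  by apply: alm; rewrite /= -ltnS prednK.
have Ng2 n (i : 'I_s) : (0 < N n)%N -> Nr n `^ alpha i <= Nr n `^ alpha1.
  by move=> n0; apply: ler_powR; [rewrite ler1n|exact: alm].
have Ng3 n (i : 'I_s) : (0 < N n)%N -> Nr n `^ alpha i <= Nr n.
  move=> n0; rewrite -[leRHS]powRr1 ?ler0n //; apply: ler_powR; first by rewrite ler1n.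
  by case/andP: (al01 i) => _ /ltW.
have dvec0 n i : 0 < dvec n 0 i by rewrite mxE; case: (splitP i).
have [nB HB] : exists nB, forall n, (nB <= n)%N ->
    near_isometry (L0 n *m diag_mx (\row_i (Num.sqrt (dvec n 0 i))^-1)).
  have [nB HB] := HL0 2^-1 (ltac:(by rewrite invr_gt0)); exists nB => n /HB.
  rewrite ger0_norm ?specnorm_ge0 // => h; apply: near_isometry_spec.
  by rewrite trmx_mul tr_diag_mx !mulmxA.
(* Source loadings are all scaled by [N]; the maximum with 1 keeps the scale positive at every index
   and disappears once [N n > 0]. *)
pose dk n := const_mx (maxn 1 (N n))%:R : 'rV[R]_s.
have sW : sbounded P (fun M n _ => forall i,
    Nr n `^ alpha i <= M * dW n 0 i /\ dW n 0 i <= M * Nr n `^ alpha i).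
  apply: sbounded_forall => i; apply: same_order_sbounded (soW i) _ _.
    by move=> n; exact: ltW.
  by move=> n; exact: powR_ge0.
have sS : sbounded P (fun M n _ => forall i,
    Nr n <= M * dS n 0 i /\ dS n 0 i <= M * Nr n).
  apply: sbounded_forall => i; apply: same_order_sbounded (soS i) _ _ => n.
    exact: ltW.
  exact: ler0n.
have sd : sbounded P (fun M n _ => forall i,
    g n <= M * dvec n 0 i /\ dvec n 0 i <= M * Nr n).
  apply: (sbounded_imply (sbounded_and sW sS)) => B B1; exists B => //.
  exists nN => n w /HN0 n0 [hW hS] M' BM' i.
  have M'0 : 0 <= M' by lra.
  have wk a b c : 0 < c -> a <= B * c /\ c <= B * b -> 0 <= b -> a <= M' * c /\ c <= M'
    * b.
    move=> c0 [h1 h2] b0; split; first by apply: le_trans h1 _; rewrite ler_wpM2r // ltW.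
    by apply: le_trans h2 _; rewrite ler_wpM2r.
  rewrite mxE; case: (splitP i) => k _.
    have [] := wk _ _ _ (dS0 n k) (hS k) (ler0n _ _) => h1 h2; split => //.
    by apply: le_trans h1; exact: Ng3.
  have [] := wk _ _ _ (dW0 n k) (hW k) (powR_ge0 _ _) => h1 h2; split.
    by apply: le_trans h1; exact: Ng1.
  by apply: le_trans h2 _; rewrite ler_wpM2l //; exact: Ng3.
have mF0 n i j : measurable_fun setT (fun w => F0 n w i j).
  exact: mx_measurable_row_mx (mFs n) (mFw n) i j.
have sF0 := gram_sbounded HT0 HF0 pd0.
have sEF0 := cross_sbounded HN HT0 mF0 mE HC0.
have sE0 : sbounded P (fun M n w => specnorm (E0 n w) ^+ 2 <= M * Num.max (Nr n) (T0r n)).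
  have := Op_sbounded (X := fun n w => specnorm (E0 n w) ^+ 2) _ HE0.
  move=> /(_ _)/wrap[n|]; first by rewrite le_max ler0n.
  by move=> h; apply: (sbounded_weaken h) => M' n w; rewrite ger0_norm // sqr_ge0.
have sEB0 := weighted_sbounded (A := fun n => Dis n *m (L0 n)^T) HT0 mE HA4.
have sQ0 := projection_sbounded HN HT0 sF0 sEF0 sE0 dvec0 sd HB (fun n h => Ng0 n (HN0
  n h)) HA6 hQ0.
have LkB n k : (nN <= n)%N -> row_mx (const_mx (maxn 1 (N n))%:R) (const_mx (maxn 1 (N
  n))%:R) = const_mx (Nr n) :> 'rV[R]_(s + rc k).
  by move=> /HN0 n0; rewrite row_mx_const (maxn_idPr n0).
have sHk : forall k, exists nk, forall n, (nk <= n)%N -> near_isometry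
    (Lk n k *m diag_mx (\row_i (Num.sqrt (row_mx (dk n) (const_mx (maxn 1 (N n))%:R :
      'rV[R]_(rc k)) 0 i))^-1)).
  move=> k; have [nk Hk] := HLk k 2^-1 (ltac:(by rewrite invr_gt0)).
  exists (maxn nN nk) => n; rewrite geq_max => /andP[nn /Hk].
  rewrite ger0_norm ?specnorm_ge0 // => h; apply: near_isometry_spec.
  rewrite LkB // (_ : diag_mx _ = ((Num.sqrt (Nr n))^-1)%:M); last first.
    by apply/matrixP => i j; rewrite !mxE.
  rewrite mul_mx_scalar [(_ *: _)^T]linearZ /= -scalemxAl -scalemxAr scalerA.
  by rewrite -invfM -expr2 sqr_sqrtr ?ler0n.
have sQk k : sbounded P (fun M n w =>
    fnorm (Qhatk n k w *m (Qhatk n k w)^T - projP (Lk n k)) <=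
    M * (Nr n / (Num.sqrt (Tkr k n) * Nr n) + (Nr n)^-1)).
  have sFk := gram_sbounded (HTk k) (HFk k) (pdk k).
  have sEFk := cross_sbounded HN (HTk k) (fun n => mFk n k) (fun n => mEk n k) (fun n
    => HCk n k).
  have sEk : sbounded P (fun M n w => specnorm (Ek n k w) ^+ 2 <= M * Num.max (Nr n)
    (Tkr k n)).
    have := Op_sbounded (X := fun n w => specnorm (Ek n k w) ^+ 2) _ (HEk k).
    move=> /(_ _)/wrap[n|]; first by rewrite le_max ler0n.
    by move=> h; apply: (sbounded_weaken h) => M' n w; rewrite ger0_norm // sqr_ge0.
  have [nk Hk] := sHk k.
  apply: (projection_sbounded (L := fun n => Lk n k) HN (HTk k) sFk sEFk sEk _ _ Hk _ _
    (fun n w => hQk n k w)).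
  - by move=> n i; rewrite row_mx_const mxE ltr0n leq_max.
  - apply: (@sbounded_det _ _ _ _ _ 1 nN) => n M' nn _ M'1 i.
    by rewrite LkB // mxE; split; rewrite ler_peMl // ler0n.
  - by move=> n /HN0 n0; rewrite /Nr ltr0n.
  - exact: small_source (HTk k).
have {}sQk := sbounded_forall sQk.
have [nT HT00] := diverges_gt0 HT0.
(* One index for the finitely many sources, taken as the maximum of the individual ones. *)
have [nK HnK] : exists nK, forall n, (nK <= n)%N -> forall k, (0 < Tk k n)%N /\
  near_isometry
    (Lk n k *m diag_mx (\row_i (Num.sqrt (row_mx (dk n) (const_mx (maxn 1 (N n))%:R :
      'rV[R]_(rc k)) 0 i))^-1)).
  have /choice[f Hf] : forall k, exists nk, forall n, (nk <= n)%N -> (0 < Tk k n)%N /\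
    near_isometry
    (Lk n k *m diag_mx (\row_i (Num.sqrt (row_mx (dk n) (const_mx (maxn 1 (N n))%:R :
      'rV[R]_(rc k)) 0 i))^-1)).
    move=> k; have [n1 h1] := diverges_gt0 (HTk k); have [n2 h2] := sHk k.
    by exists (maxn n1 n2) => n; rewrite geq_max => /andP[/h1 ? /h2].
  exists (\max_k f k) => n hn k; apply: Hf; apply: leq_trans hn.
  exact: leq_bigmax.
pose H n w := trans_rotation (Lw n) (Qw n w) (dW n).
have eps0 n : 'I_K -> 0 <= eps n by move=> k; apply: le_trans (HA5 n k); exact: fnorm_ge0.
have rate0 n : 0 <= rate n.
  have Tt0 : 0 <= Ttot n.
    by rewrite addr_ge0 ?ler0n // sumr_ge0 // => k _; exact: ler0n.
  have N0 := ler0n R (N n); have t00 := ler0n R (T0 n); have tk0 k := ler0n R (Tk k n).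
  have g0 : 0 <= Nr n `^ alphas := powR_ge0 _ _.
  apply: addr_ge0; [apply: addr_ge0; [apply: addr_ge0|]|].
  - by rewrite divr_ge0 ?mulr_ge0 ?sqrtr_ge0.
  - by rewrite divr_ge0 ?mulr_ge0.
  - apply: sumr_ge0 => k _; apply: addr_ge0; first by rewrite divr_ge0 ?sqrtr_ge0.
    by rewrite divr_ge0 ?mulr_ge0.
  - rewrite mulr_ge0 ?invr_ge0 // sumr_ge0 // => k _.
    by rewrite mulr_ge0 // eps0.
have HQQ n w : (Qw n w)^T *m Qw n w = 1%:M by case: (hQw n w).
(* The factor estimate is proved against the sum of its two rates; [Op_split] then separates
   them. *)
suff key : sbounded P (fun C n w =>
    specnorm (Lamhat n w - Lw n *m H n w) / Num.sqrt (Nr n) <=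
      C * (Num.sqrt (Nr n `^ alpha1) / Num.sqrt (Nr n) * rate n) /\
    specnorm (Fhat n w - F0w n w *m (invmx (H n w))^T) / Num.sqrt (T0r n) <=
      C * (Num.sqrt (Nr n) / Num.sqrt (g n) * rate n + 1 / Num.sqrt (g n))).
  exists H; split; first by move=> n w; exact: trans_rotation_unitmx.
  split.
    apply: sbounded_Op; apply: (sbounded_weaken key) => C n w [h _].
    by rewrite ger0_norm // divr_ge0 ?specnorm_ge0 ?sqrtr_ge0.
  have [] := @Op_split _ _ _ P (fun n w => specnorm (Fhat n w - F0w n w *m (invmx (H n
    w))^T) / Num.sqrt (T0r n))
     (fun n => Num.sqrt (Nr n) / Num.sqrt (g n) * rate n) (fun n => 1 / Num.sqrt (g n))
       nN.
  - by move=> n; rewrite mulr_ge0 ?divr_ge0 ?sqrtr_ge0.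
  - by move=> n; rewrite divr_ge0 ?sqrtr_ge0.
  - by move=> n /HN0 /Ng0 gn; rewrite divr_gt0 ?sqrtr_gt0.
  - apply: (sbounded_weaken key) => C n w [_ h].
    by rewrite ger0_norm // divr_ge0 ?specnorm_ge0 ?sqrtr_ge0.
  by move=> Y [Z [h1 h2 h3]]; exists Y, Z.
apply: (sbounded_imply (sbounded_and (sbounded_and (sbounded_and sQ0 sQk) (sbounded_and
  sW sd))
   (sbounded_and sF0 (sbounded_and sE0 sEB0)))) => B B1.
have B0 : 0 <= B by lra.
(* The summands pay for the stochastic bounds themselves, the norms of the weak and of the strong
   loadings, and the constant of [subspace_perturbation]. *)
pose Mt := B * (1 + 2 * s%:R + 2 * r0s%:R + 4 / kap * (s%:R + 1)).
have s0 := ler0n R s; have q0 := ler0n R r0s.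
have k0 : 0 <= 4 / kap * (s%:R + 1) by rewrite mulr_ge0 ?addr_ge0 // divr_ge0 // ltW.
have Mt1 : 1 <= Mt by rewrite /Mt; nra.
have MMt : B <= Mt by rewrite /Mt; nra.
have MMs : 2 * s%:R * B <= Mt by rewrite /Mt; nra.
have MMq : 2 * r0s%:R * B <= Mt by rewrite /Mt; nra.
have MMk : 4 / kap * (s%:R + 1) * B <= Mt by rewrite /Mt; nra.
have Mt4 : 1 <= Mt ^+ 4 by exact: exprn_ege1.
exists (8 * Mt ^+ 4 * (s%:R + 2)); first by nra.
exists (maxn (maxn nN nT) (maxn nB nK)) => n w.
rewrite !geq_max => /andP[/andP[/HN0 n0 /HT00 t0] /andP[/HB hB /HnK hK]].
move=> [[[q0n qkn] [dWn dn]] [[_ F0n] [E0n EB0n]]] C HC.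
have Nr0 : 0 < Nr n by rewrite ltr0n.
have T0r0 : 0 < T0r n by rewrite ltr0n.
have Tkr0 k : 0 < Tkr k n by rewrite ltr0n; case: (hK k).
have Tt0 : 0 < Ttot n by rewrite ltr_wpDr // sumr_ge0 // => k _; exact: ltW.
have gn := Ng0 n n0.
have a10 : 0 < Nr n `^ alpha1 by rewrite powR_gt0.
have hBs := block_near_isometryl hB; have hBw := block_near_isometryr hB.
have Lwu := scaled_gram_unitmx (dW0 n) hBw.
have Lsu := scaled_gram_unitmx (dS0 n) hBs.
have Pwp := orthproj_projP Lwu; have Psp := orthproj_projP Lsu.
have PsPw : projP (Ls n) *m projP (Lw n) = 0.
  by apply: (block_projP_orth (dS0 n) (dW0 n) hB); rewrite -/(L0 n) HP0 addrC.
have dk0 (r : nat) (i : 'I_r) : 0 < (const_mx (maxn 1 (N n))%:R : 'rV[R]_r) 0 i.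
  by rewrite mxE ltr0n leq_max.
have PCp k : orthproj (projP (LTc n k)).
  apply: orthproj_projP; have [_ h] := hK k.
  exact: scaled_gram_unitmx (dk0 _) (block_near_isometryr h).
have PTp k : orthproj (projP (LT n k)).
  apply: orthproj_projP; have [_ h] := hK k.
  exact: scaled_gram_unitmx (dk0 _) (block_near_isometryl h).
have PCT k : projP (LTc n k) *m projP (LT n k) = 0.
  have [_ h] := hK k.
  have PTC := block_projP_orth (dk0 _) (dk0 _) h (HPk n k).
  by rewrite -(PCp k).1 -(PTp k).1 -trmx_mul PTC trmx0.
have err := aggregate_error (Qhat0 n w *m (Qhat0 n w)^T) (projP (Ls n))
  (fun k => Qhatk n k w *m (Qhatk n k w)^T) (fun k => projP (LTc n k))
  T0r0 (fun k => ltW (Tkr0 k)) (HA5 n).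
have crs := aggregate_cross T0r0 (fun k => ltW (Tkr0 k)) (HA5 n) Pwp PsPw PCp PCT.
(* Bounds the aggregation error and also the cross term, which is only its [eps] part. *)
have tot_rate : (Ttot n)^-1 * (T0r n * fnorm (Qhat0 n w *m (Qhat0 n w)^T - (projP (Lw
  n) + projP (Ls n))) +
   \sum_k Tkr k n * (fnorm (Qhatk n k w *m (Qhatk n k w)^T - (projP (LT n k) + projP
     (LTc n k))) + eps n)) <= B * rate n.
  apply: le_trans (rate_bound T0r0 Tkr0 Tt0 Nr0 gn B1 (eps0 n)).
  rewrite ler_pM2l ?invr_gt0 //; apply: lerD.
    by rewrite ler_pM2l // -HP0; exact: q0n.
  apply: ler_sum => k _; rewrite ler_pM2l // lerD2r -HPk; exact: qkn.
have Phat_sym : (Phat n w)^T = Phat n w.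
  rewrite /Phat [LHS]linearZ /= [(_ + _)^T]linearD /= [(T0r n *: _)^T]linearZ /=
    trmx_mul trmxK; congr (_ *: (_ + _)).
  rewrite linear_sum; apply: eq_bigr => k _.
  by rewrite linearZ /= trmx_mul trmxK.
have hrho : fnorm ((1%:M - projP (Lw n)) *m Qw n w) <= Mt * rate n.
  have hS : specnorm ((Ttot n)^-1 *: (T0r n *: projP (Ls n) + \sum_k Tkr k n *: projP
    (LTc n k))) <= 1 - kap.
    by apply: le_trans (HK n); apply: specnormZ_le; rewrite invr_ge0 ltW.
  have crs' : fnorm ((Ttot n)^-1 *: (T0r n *: projP (Ls n) + \sum_k Tkr k n *: projP
    (LTc n k)) *m projP (Lw n)) <= B * rate n.
    apply: le_trans crs _; apply: le_trans tot_rate.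
    rewrite ler_pM2l ?invr_gt0 //; apply: le_trans (_ : 0 + _ <= _); first by rewrite
      add0r.
    apply: lerD; first by rewrite mulr_ge0 ?fnorm_ge0 // ltW.
    by apply: ler_sum => k _; rewrite ler_pM2l // lerDr fnorm_ge0.
  have := subspace_perturbation Lwu Phat_sym (hQw n w) kap0 (le_trans err tot_rate)
    crs' hS.
  move=> h; apply: le_trans h _; rewrite mulrA ler_wpM2r //.
have hd1 j : dW n 0 j <= Mt * Nr n `^ alpha1.
  apply: le_trans (dWn j).2 _; apply: ler_pM; rewrite ?powR_ge0 //; exact: Ng2.
have hd2 j : g n <= Mt * dW n 0 j.
  apply: le_trans (Ng1 n j n0) _; apply: le_trans (dWn j).1 _.
  by rewrite ler_wpM2r // ltW.
have hLw1 : fnorm (Lw n) ^+ 2 <= Mt * Nr n `^ alpha1.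
  apply: le_trans (scaled_fnorm (b := B * Nr n `^ alpha1) (dW0 n) hBw _ _) _.
  - by rewrite mulr_ge0 ?powR_ge0.
  - by move=> j; apply: le_trans (dWn j).2 _; rewrite ler_wpM2l //; exact: Ng2.
  - by rewrite mulrA ler_wpM2r ?powR_ge0.
have a1N : Nr n `^ alpha1 <= Nr n by exact: Ng3.
have hLw : fnorm (Lw n) ^+ 2 <= Mt * Nr n.
  by apply: le_trans hLw1 _; rewrite ler_wpM2l //; lra.
have hLs : fnorm (Ls n) ^+ 2 <= Mt * Nr n.
  apply: le_trans (scaled_fnorm (b := B * Nr n) (dS0 n) hBs _ _) _.
  - by rewrite mulr_ge0 // ltW.
  - by move=> j; have := (dn (lshift s j)).2; rewrite /dvec row_mxEl.
  - by rewrite mulrA ler_wpM2r // ltW.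
have wkT x : x <= B * T0r n -> x <= Mt * T0r n.
  by move=> h; apply: le_trans h _; rewrite ler_wpM2r // ltW.
have F0E : fnorm (F0 n w) ^+ 2 = fnorm (F0s n w) ^+ 2 + fnorm (F0w n w) ^+ 2.
  exact: fnorm_row_mx.
have fs0 := sqr_ge0 (fnorm (F0s n w)); have fw0 := sqr_ge0 (fnorm (F0w n w)).
have hFs : fnorm (F0s n w) ^+ 2 <= Mt * T0r n by apply: wkT; lra.
have hFw : fnorm (F0w n w) ^+ 2 <= Mt * T0r n by apply: wkT; lra.
have hE : specnorm (E0 n w) ^+ 2 <= Mt * Num.max (Nr n) (T0r n).
  by apply: le_trans E0n _; rewrite ler_wpM2r // le_max ltW.
(* The weak part is a column block of the full normalised product that (A4) bounds. *)
have hEB : fnorm (E0 n w *m (Lw n *m diag_mx (\row_i (Num.sqrt (dW n 0 i))^-1))) ^+ 2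
  <= Mt * T0r n.
  apply: wkT; apply: le_trans EB0n.
  rewrite trmx_mul trmxK /Dis tr_diag_mx (mul_row_mx_diag _ _ (fun x => (Num.sqrt x)^-1)).
  by rewrite mul_mx_row fnorm_row_mx lerDr sqr_ge0.
have orth : (Ls n)^T *m projP (Lw n) = 0.
  have <- : (projP (Ls n) *m Ls n)^T = (Ls n)^T by rewrite projP_mul.
  by rewrite trmx_mul Psp.1 -mulmxA PsPw mulmx0.
have gN : g n <= Nr n by exact: Ng3.
have sN0 : 0 < Num.sqrt (Nr n) by rewrite sqrtr_gt0.
have sT0 : 0 < Num.sqrt (T0r n) by rewrite sqrtr_gt0.
split.
  apply: (@le_trans _ _ (8 * Mt ^+ 4 * (s%:R + 2) * (Num.sqrt (Nr n `^ alpha1) /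
    Num.sqrt (Nr n) * rate n))).
    rewrite ler_pdivrMr //; apply: le_trans (specnorm_le_fnorm _) _.
    have := transfer_loading Mt1 (dW0 n) a10 (HQQ n w) hBw hd1 hLw1 hrho.
    move=> h; apply: le_trans h _.
    by rewrite le_eqVlt; apply/orP; left; apply/eqP; field; rewrite gt_eqF.
  by rewrite ler_wpM2r // mulr_ge0 // divr_ge0 ?sqrtr_ge0.
apply: (@le_trans _ _ (8 * Mt ^+ 4 * (s%:R + 2) * (Num.sqrt (Nr n) / Num.sqrt (g n) *
  rate n + 1 / Num.sqrt (g n)))).
  rewrite ler_pdivrMr //; apply: le_trans (specnorm_le_fnorm _) _.
  have := transfer_factor Mt1 (dW0 n) gn t0 n0 (HQQ n w) hBw hd2 hrho gN orth hLw hLs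
    hFs hFw hE hEB.
  move=> h; apply: le_trans h _; rewrite div1r.
  by rewrite le_eqVlt; apply/orP; left; apply/eqP; ring.
by rewrite ler_wpM2r // addr_ge0 ?mulr_ge0 ?divr_ge0 ?sqrtr_ge0.
Qed.
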